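(* Let $G$ be a subgroup of $\mathrm{GL}(d,\mathbb{R})$ and let $V$ be a finite-dimensional vector subspace of $X_d$. Suppose that there is $z_0\in\mathbb{R}^d$ such that $\Lambda_{G,z_0}$ has nonempty interior in $\mathbb{R}^d$, that $\tau_h(V)\subseteq V$ for all $h\in\mathbb{R}^d$, and that $O_P(V)\subseteq V$ for all $P\in G$. Then every element of $V$ is an ordinary polynomial in $d$ real variables.
   Context: $X_d$ denotes either $C(\mathbb{R}^d)$ (real-valued continuous functions) or $\mathcal{D}(\mathbb{R}^d)'$ (real-valued Schwartz distributions). For $g\in C(\mathbb{R}^d)$, $h\in\mathbb{R}^d$, $P\in\mathrm{GL}(d,\mathbb{R})$: $\tau_hg(x)=g(x+h)$ and $O_Pg(x)=g(Px)$. For $f\in\mathcal{D}(\mathbb{R}^d)'$ and a test function $\phi$: $\tau_h(f)\{\phi\}=f\{\phi(\cdot-h)\}$ and $O_P(f)\{\phi\}=\frac{1}{|\det P|}f\{\phi(P^{-1}\cdot)\}$. For a subgroup $G\subseteq\mathrm{GL}(d,\mathbb{R})$ and $z_0\in\mathbb{R}^d$, $\Lambda_{G,z_0}=\{Pz_0-Qz_0: P,Q\in G\}$. A distribution is an ordinary polynomial if it coincides, as a distribution, with an element of $\mathbb{R}[x_1,\dots,x_d]$ (for continuous functions this means equality everywhere). *)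

(* Defs.v *)
From HB Require Import structures.
From mathcomp Require Import all_boot all_order all_algebra.
From mathcomp Require Import all_classical all_reals all_analysis.
Set Implicit Arguments. Unset Strict Implicit. Unset Printing Implicit Defensive.
Import Order.TTheory GRing.Theory Num.Theory.
Import numFieldNormedType.Exports.
Local Open Scope classical_set_scope.
Local Open Scope ring_scope.

Section Defs.
Variables (R : realType) (d : nat).
Notation pt := 'cV[R]_d.

Definition ebasis (i : 'I_d) : pt := delta_mx i 0.

Definition dseq (s : seq 'I_d) (f : pt -> R) : pt -> R :=
  foldr (fun i g => fun x => 'D_(ebasis i) g x) f s.

Definition smooth (f : pt -> R) : Prop :=
  forall s : seq 'I_d, continuous (dseq s f) /\
    forall (i : 'I_d) (x : pt), derivable (dseq s f) x (ebasis i).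

Definition supp_in_ball (M : R) (f : pt -> R) : Prop :=
  forall x : pt, M < `|x| -> f x = 0.

Definition test_fun (phi : pt -> R) : Prop :=
  smooth phi /\ exists M : R, supp_in_ball M phi.

(* a (candidate) distribution is a functional on functions R^d -> R;
   only its values on test functions matter *)
Definition distrib_fun := (pt -> R) -> R.

Definition is_distribution (T : distrib_fun) : Prop :=
  (forall phi psi (a : R), test_fun phi -> test_fun psi ->
      T (fun x => phi x + a * psi x) = T phi + a * T psi) /\
  (forall (phi : nat -> pt -> R) (M : R),
      (forall n, test_fun (phi n)) ->
      (forall n, supp_in_ball M (phi n)) ->
      (forall s (e : R), 0 < e -> exists N, forall n x, (N <= n)%N ->
           `|dseq s (phi n) x| < e) ->
      (fun n => T (phi n)) @ \oo --> (0 : R)).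

Definition deq (T S : distrib_fun) : Prop :=
  forall phi, test_fun phi -> T phi = S phi.

Definition dtau (h : pt) (T : distrib_fun) : distrib_fun :=
  fun phi => T (fun x => phi (x - h)).
Definition dO (P : 'M[R]_d) (T : distrib_fun) : distrib_fun :=
  fun phi => (`|\det P|)^-1 * T (fun x => phi (invmx P *m x)).

Definition ftau (h : pt) (g : pt -> R) : pt -> R := fun x => g (x + h).
Definition fO (P : 'M[R]_d) (g : pt -> R) : pt -> R := fun x => g (P *m x).

Definition is_poly_fun (p : pt -> R) : Prop :=
  exists (n : nat) (c : 'I_n -> R) (a : 'I_n -> 'I_d -> nat),
    forall x : pt, p x = \sum_(k < n) c k * \prod_(i < d) x i 0 ^+ a k i.

(* Integral over R^d, as the iterated Lebesgue integral over the coordinates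
   (used only for continuous compactly supported integrands, where it
   coincides with the d-dimensional Lebesgue integral by Fubini). *)
Definition set_coord (k : nat) (t : R) (x : pt) : pt :=
  \col_i (if nat_of_ord i == k then t else x i 0).
Fixpoint iint (k : nat) (f : pt -> R) (x : pt) : R :=
  match k with
  | 0%N => f x
  | k'.+1 => Rintegral (@lebesgue_measure R) setT
               (fun t => iint k' f (set_coord k' t x))
  end.
Definition integral_Rd (f : pt -> R) : R := iint d f 0.

Definition distr_is_poly (T : distrib_fun) : Prop :=
  exists p : pt -> R, is_poly_fun p /\
    forall phi, test_fun phi -> T phi = integral_Rd (fun x => p x * phi x).

Definition is_subgroup_GL (G : set 'M[R]_d) : Prop :=
  (forall P, G P -> P \in unitmx) /\ G 1%:M /\
  (forall P Q, G P -> G Q -> G (P *m Q)) /\ (forall P, G P -> G (invmx P)).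

Definition Lambda (G : set 'M[R]_d) (z0 : pt) : set pt :=
  [set y | exists P Q, G P /\ G Q /\ y = P *m z0 - Q *m z0].

Definition fdim_subspace_C (V : set (pt -> R)) : Prop :=
  (forall f, V f -> continuous f) /\
  V (fun _ => 0) /\
  (forall f g, V f -> V g -> V (fun x => f x + g x)) /\
  (forall (a : R) f, V f -> V (fun x => a * f x)) /\
  exists (n : nat) (b : 'I_n -> pt -> R), forall f, V f ->
    exists c : 'I_n -> R, forall x, f x = \sum_(i < n) c i * b i x.

(* V is a finite-dimensional vector subspace of D(R^d)'
   (elements represented by functionals, compared via deq) *)
Definition fdim_subspace_D (V : set distrib_fun) : Prop :=
  (forall T, V T -> is_distribution T) /\
  V (fun _ => 0) /\
  (forall T S, V T -> V S -> V (fun phi => T phi + S phi)) /\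
  (forall (a : R) T, V T -> V (fun phi => a * T phi)) /\
  exists (n : nat) (b : 'I_n -> distrib_fun), forall T, V T ->
    exists c : 'I_n -> R, deq T (fun phi => \sum_(i < n) c i * b i phi).

End Defs.

(* Main.v *)
Require Import Defs.
From HB Require Import structures.
From mathcomp Require Import all_boot all_order all_algebra.
From mathcomp Require Import all_classical all_reals all_analysis.
From mathcomp Require Import complex ring lra zify.
Set Implicit Arguments. Unset Strict Implicit. Unset Printing Implicit Defensive.
Import Order.TTheory GRing.Theory Num.Theory.
Import numFieldNormedType.Exports.
Local Open Scope classical_set_scope.
Local Open Scope ring_scope.

(** Translations act on the finite-dimensional space [V] by commuting matrices [M h], and [O_P]
    conjugates [M h] into [M (P h)]. Hence the eigenvalues of [M (P z0 - Q z0)] are quotients of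
    eigenvalues of [M z0]: a finite set. As these vectors fill a ball, every [M h] is unipotent,
    so that [(tau_h - 1)^m = 0] on [V] for some [m].

    For a continuous function, Newton interpolation on arithmetic progressions and density of
    the rationals give polynomiality in each variable with explicit coefficients, and one
    eliminates the variables one after the other.

    For a distribution [T], the function [s |-> T (f (. - s e_i))] is, on the rationals, a
    polynomial of degree less than [m] whose derivative is minus the one attached to [d_i f];
    hence [T (d_i^m f) = 0]. If [eta] is a bump function of [x_i] with integral [1], then
    [f = eta . (integral of f along e_i) + d_i (J f)] with [J f] a test function. Iterating
    this [m] times expresses [T f] by finitely many moments of [f] along [e_i], the moments of
    [J f] being moments of [f] by partial integration. Treating the coordinates in turn leaves a
    combination of integrals of [f] against monomials. *)

(** * Unipotent representations *)

(** Translation invariance alone allows exponential polynomials: [exp] spans a translation-invariant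
    line. Only the action of [G] forces the eigenvalues to be [1]. No continuity of [h |-> M h] is
    established, so the finiteness of the eigenvalue set is exploited arithmetically: [h] is cut
    into so many equal parts that a long enough progression of step [h'] stays in the ball, and the
    pigeonhole principle does the rest.

    The analysis rests on functions with bounded partial derivatives of all orders: uniform
    quadratic remainders replace dominated convergence when an integral is differentiated. For
    distributions, rational translations suffice, because the steps [1 / (k + 1)] already compute a
    derivative. A primitive along [e_i] keeps a bounded support only if the integral along each line
    vanishes, whence the correction by [eta]. Coordinates are eliminated in the order in which
    [iint] integrates them, so that no exchange of integrals occurs. *)

Lemma eigenvalue_comm_pair (C : numClosedFieldType) n (A B : 'M[C]_n) a :
  A *m B = B *m A -> eigenvalue A a ->
  exists (v : 'rV_n) (b : C), [/\ v != 0, v *m A = a *: v & v *m B = b *: v].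
Proof.
(* As [A] and [B] commute, [B] acts on the eigenspace of [A], where it has an eigenvalue because [C]
   is algebraically closed. *)
move=> cAB ea; have [|b] := @eigenvalue_closed _ _ (restrictmx (eigenspace A a) B).
  by rewrite lt0n mxrank_eq0.
case/eigenvalueP => w wB w0; exists (w *m row_base (eigenspace A a)), b; split.
- by rewrite mulmx_free_eq0 ?row_base_free.
- by apply/eigenspaceP; rewrite mulmx_sub// eq_row_base.
have stB : stablemx (row_base (eigenspace A a)) B.
  by rewrite stablemx_row_base comm_mx_stable_eigenspace.
by rewrite -mulmxA -(mulmxKpV stB) mulmxA wB scalemxAl.
Qed.

(** Pigeonhole: the [size E + 1] numbers [m * l ^+ j] cannot be distinct, and cancelling in a
    coincidence leaves a power of [l] equal to [1]. *)
Lemma exp_coincidence (F : fieldType) (E : seq F) (m l : F) :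
    m != 0 -> l != 0 -> (forall j, (j <= size E)%N -> m * l ^+ j \in E) ->
  exists2 k, (0 < k <= size E)%N & l ^+ k = 1.
Proof.
move=> m0 l0 lE; pose s := [seq m * l ^+ j | j <- iota 0 (size E).+1].
have : ~~ uniq s.
  apply/negP => us.
  have sE : {subset s <= E}.
    by move=> x /mapP[j]; rewrite mem_iota ltnS => jE ->; exact: lE.
  by have := uniq_leq_size us sE; rewrite size_map size_iota ltnn.
case/(uniqPn 0) => i [j [ij]]; rewrite size_map size_iota => jE.
rewrite !(nth_map 0%N) ?size_iota ?(ltn_trans ij)// !nth_iota ?(ltn_trans ij)//.
rewrite !add0n => /(mulfI m0) eij.
exists (j - i)%N; first by rewrite subn_gt0 ij (leq_trans (leq_subr _ _)).
apply: (mulfI (expf_neq0 i l0)).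
by rewrite -exprD subnKC 1?ltnW// mulr1.
Qed.

(** Over the complex numbers the characteristic polynomial is a power of [X - 1]; this identity
    descends to [R], and Cayley-Hamilton concludes. *)
Lemma eigenvalue1_unipotent (R : rcfType) n (A : 'M[R]_n.+1) :
    (forall a, eigenvalue (map_mx (real_complex R) A) a -> a = 1) ->
  (A - 1) ^+ n.+1 = 0.
Proof.
move=> e1; pose f := real_complex R; pose B := map_mx f A.
have [r Er] := closed_field_poly_normal (char_poly B).
have /monicP lc1 := char_poly_monic B.
have r1 z : z \in r -> z = 1.
  move=> zr; apply: e1; rewrite eigenvalue_root_char Er lc1 scale1r.
  by rewrite root_prod_XsubC.
have sr : size r = n.+1.
  by apply: succn_inj; rewrite -(size_char_poly B) [in RHS]Er lc1 scale1r size_prod_XsubC.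
have Ep : char_poly B = ('X - 1%:P) ^+ n.+1.
  rewrite Er lc1 scale1r (eq_big_seq (fun=> 'X - 1%:P)) => [|z /r1->//].
  by rewrite big_const_seq count_predT sr iter_mulr_1.
have EA : char_poly A = ('X - 1%:P) ^+ n.+1.
  apply: (map_poly_inj f); rewrite map_char_poly -/B Ep.
  by rewrite rmorphXn rmorphB /= map_polyX map_polyC rmorph1.
have := Cayley_Hamilton A; rewrite EA rmorphXn rmorphB /= horner_mx_X.
by rewrite horner_mx_C.
Qed.

(* The eigenvalues of [M (P *m z0)] do not depend on [P], so those of [M y] for [y] in [Lambda]
   lie in a finite set. If [h = h' *+ (N`! * L)] and [y0 + h' *+ j] is in [Lambda] for all
   [j <= N], the powers of an eigenvalue of [M h'] must repeat; hence that eigenvalue is a root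
   of unity of order at most [N], and its power of exponent [N`! * L] is [1]. *)
Lemma matrix_rep_unipotent (R : rcfType) (d m : nat) (G : 'M[R]_d -> Prop)
    (z0 : 'cV[R]_d) (M : 'cV[R]_d -> 'M[R]_m.+1) (h : 'cV[R]_d) :
    M 0 = 1 -> {morph M : x y / x + y >-> x * y} ->
    (forall P x, G P ->
      exists2 N : 'M[R]_m.+1, N \in unitmx & N *m M x = M (P *m x) *m N) ->
    (forall N K : nat, (0 < K)%N -> exists L (y0 h' : 'cV[R]_d),
      h = h' *+ (K * L) /\ forall j, (j <= N)%N ->
        exists P Q, [/\ G P, G Q & y0 + h' *+ j = P *m z0 - Q *m z0]) ->
  (M h - 1) ^+ m.+1 = 0.
Proof.
move=> M0 MD MG Mh; apply: eigenvalue1_unipotent.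
pose f := real_complex R; pose MC x := map_mx f (M x).
have MC0 : MC 0 = 1%:M by rewrite /MC M0 map_mx1.
have MCD x y : MC (x + y) = MC x *m MC y by rewrite /MC MD map_mxM.
have MCX x k : MC (x *+ k) = MC x ^+ k.
  by elim: k => [|k IH]; rewrite ?mulr0n ?MC0// mulrS MCD IH exprS.
have MCc x y : MC x *m MC y = MC y *m MC x by rewrite -!MCD addrC.
have eig0 x (v : 'rV_m.+1) a : v != 0 -> v *m MC x = a *: v -> a != 0.
  move=> v0 va; apply: contraNneq v0 => a0.
  rewrite -[v]mulmx1 -MC0 -(subrr x) MCD mulmxA va a0 scale0r mul0mx //.
have eigP P (v : 'rV_m.+1) a : G P -> v != 0 -> v *m MC (P *m z0) = a *: v ->
    eigenvalue (MC z0) a.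
  move=> GP v0 va; have [N Nu NM] := MG P z0 GP.
  have NMC : map_mx f N *m MC z0 = MC (P *m z0) *m map_mx f N.
    by rewrite -!map_mxM NM.
  apply/eigenvalueP; exists (v *m map_mx f N).
    by rewrite -mulmxA NMC mulmxA va scalemxAl.
  by rewrite mulmx_free_eq0// row_free_unit map_unitmx.
have [r Er] := closed_field_poly_normal (char_poly (MC z0)).
have rP a : eigenvalue (MC z0) a -> a \in r.
  rewrite eigenvalue_root_char Er rootZ ?root_prod_XsubC//.
  by rewrite lead_coef_eq0 monic_neq0// char_poly_monic.
pose E := [seq a / b | a <- r, b <- r]; pose N := size E.
have [L [y0 [h' [hh' yL]]]] := Mh N N`! (fact_gt0 _).
move=> l; rewrite -/(MC h) => el.
(* Two eigenvectors share the eigenvalue [l'] of [MC h']: [v] relates [l'] to [l], while [w] relates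
   it to an eigenvalue of [MC y0]. *)
have [v [l' [v0 vl vl']]] := eigenvalue_comm_pair (MCc h h') el.
have [||w [mu [w0 wl wm]]] := @eigenvalue_comm_pair _ _ (MC h') (MC y0) l'.
- exact: MCc.
- by apply/eigenvalueP; exists v.
have wX j : w *m MC (y0 + h' *+ j) = (mu * l' ^+ j) *: w.
  rewrite MCD mulmxA wm -scalemxAl MCX -scalerA; congr (_ *: _).
  elim: j => [|j IH]; first by rewrite !expr0 scale1r mulmx1.
  by rewrite exprS mulmxA wl -scalemxAl IH scalerA -exprS.
have [||j jE|k /andP[k0 kN] lk1] := @exp_coincidence _ E mu l'.
- exact: eig0 w0 wm.
- exact: eig0 v0 vl'.
- have [P [Q [GP GQ yPQ]]] := yL j jE.
  have ej : eigenvalue (MC (y0 + h' *+ j)) (mu * l' ^+ j).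
    by apply/eigenvalueP; exists w.
  (* A common eigenvector of [MC (P z0 - Q z0)] and [MC (Q z0)] is one of their product [MC (P z0)];
     hence the quotient of two members of [r]. *)
  have [u [b [u0 ua ub]]] := eigenvalue_comm_pair (MCc _ (Q *m z0)) ej.
  have b0 := eig0 _ _ _ u0 ub.
  apply/allpairsP; exists (mu * l' ^+ j * b, b) => /=; split.
  + apply/rP/(eigP P u) => //; rewrite -(subrK (Q *m z0) (P *m z0)) -yPQ MCD mulmxA ua.
    by rewrite -scalemxAl ub scalerA.
  + exact/rP/(eigP Q u).
  + by rewrite mulfK.
have : l *: v = l' ^+ (N`! * L) *: v.
  rewrite -vl hh' MCX; move: (N`! * L)%N => k'.
  elim: k' => [|k' IH]; first by rewrite !expr0 scale1r mulmx1.
  by rewrite exprS mulmxA vl' -scalemxAl IH scalerA -exprS.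
have /dvdnP[q ->] : (k %| N`! * L)%N by rewrite dvdn_mulr// dvdn_fact// k0.
rewrite mulnC exprM lk1 expr1n => /eqP.
by rewrite -subr_eq0 -scalerBl scaler_eq0 (negPf v0) orbF subr_eq0 => /eqP.
Qed.

(** * Bases and matrices for finitely spanned subsets of a vector space *)

Section FiniteBasis.
Variables (R : fieldType) (W : lmodType R).

Definition lincomb m (e : 'I_m -> W) (c : 'rV[R]_m) : W := \sum_i c 0 i *: e i.

Lemma lincombD m (e : 'I_m -> W) c c' :
  lincomb e (c + c') = lincomb e c + lincomb e c'.
Proof. by rewrite -big_split; apply: eq_bigr => i _; rewrite !mxE scalerDl. Qed.

Lemma lincombZ m (e : 'I_m -> W) a c : lincomb e (a *: c) = a *: lincomb e c.
Proof. by rewrite scaler_sumr; apply: eq_bigr => i _; rewrite !mxE scalerA. Qed.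

Lemma lincombB m (e : 'I_m -> W) c c' :
  lincomb e (c - c') = lincomb e c - lincomb e c'.
Proof. by rewrite lincombD -!scaleN1r lincombZ. Qed.

Lemma lincomb0 m (e : 'I_m -> W) : lincomb e 0 = 0.
Proof. by rewrite -[0 in LHS](subrr 0) lincombB subrr. Qed.

Lemma lincomb_mul m n (e : 'I_m -> W) (b : 'I_n -> W) (D : 'M[R]_(m, n)) c :
  (forall i, e i = lincomb b (row i D)) -> lincomb e c = lincomb b (c *m D).
Proof.
move=> eD; rewrite mulmx_sum_row (big_morph _ (lincombD b) (_ : _ = 0)).
  by apply: eq_bigr => i _; rewrite lincombZ -eD.
exact: lincomb0.
Qed.

(** An independent family in [V] of maximal length is taken; lengths are at most [n] because the
    coordinate matrix over [b] is row free. Membership in [V] and injectivity allow operators on [V]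
    to be represented multiplicatively by matrices, which [b] itself does not. *)
Lemma finite_basis (V : W -> Prop) n (b : 'I_n -> W) :
    (forall w, V w -> exists c, w = lincomb b c) ->
  exists m (e : 'I_m -> W), [/\ forall i, V (e i),
    injective (lincomb e) & forall w, V w -> exists c, w = lincomb e c].
Proof.
move=> Vb.
pose P m := `[< exists e : 'I_m -> W,
  (forall i, V (e i)) /\ forall c, lincomb e c = 0 -> c = 0 >].
have P0 : exists m, P m.
  exists 0%N; apply/asboolP; exists (fun=> 0); split=> [[]//|c _].
  exact: thinmx0.
have Pn m : P m -> (m <= n)%N.
  move=> /asboolP[e [Ve ie]].
  have /choice[r er] i : exists c, e i = lincomb b c by exact: Vb.
  pose D := \matrix_i r i; have eD i : e i = lincomb b (row i D) by rewrite rowK.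
  have : row_free D.
    rewrite -kermx_eq0; apply/eqP/row_matrixP => i; rewrite row0; apply: ie.
    by rewrite (lincomb_mul _ eD) -row_mul mulmx_ker row0 lincomb0.
  by rewrite /row_free => /eqP <-; exact: rank_leq_col.
have [m /asboolP[e [Ve ie]] mmax] := ex_maxnP P0 Pn.
exists m, e; split=> //.
  move=> c c' ecc; apply/eqP; rewrite -subr_eq0; apply/eqP/ie.
  by rewrite lincombB ecc subrr.
move=> w Vw; apply: contrapT => nw.
suff /mmax : P m.+1 by rewrite ltnn.
apply/asboolP; exists (fun i => if unlift ord0 i is Some j then e j else w).
split=> [i|c]; first by case: unliftP.
rewrite /lincomb big_ord_recl unlift_none.
under eq_bigr do rewrite liftK.
move=> c0; have c0' : c 0 ord0 *: w = lincomb e (- \row_j c 0 (lift ord0 j)).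
  rewrite -scaleN1r lincombZ scaleN1r; apply/eqP; rewrite -addr_eq0; apply/eqP.
  by rewrite -[RHS]c0; congr (_ + _); apply: eq_bigr => i _; rewrite mxE.
have [c00|c0N] := eqVneq (c 0 ord0) 0.
  move: c0'; rewrite c00 scale0r => /esym/ie/eqP; rewrite oppr_eq0 => /eqP r0.
  apply/rowP => i; rewrite mxE; case: (unliftP ord0 i) => [j|] -> //.
  by have /rowP/(_ j) := r0; rewrite !mxE.
case: nw; exists ((c 0 ord0)^-1 *: (- \row_j c 0 (lift ord0 j))).
by rewrite lincombZ -c0' scalerA mulVf// scale1r.
Qed.

Lemma lincomb_matrix m (e : 'I_m -> W) (V : W -> Prop) (A : W -> W) :
    (forall i, V (e i)) -> (forall w, V w -> exists c, w = lincomb e c) ->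
    {morph A : u v / u + v} -> (forall a, {morph A : u / a *: u}) ->
    (forall w, V w -> V (A w)) ->
  exists D : 'M[R]_m, forall c, A (lincomb e c) = lincomb e (c *m D).
Proof.
move=> Ve eV AD AZ VA.
have /choice[r er] i : exists c, A (e i) = lincomb e c by exact/eV/VA.
exists (\matrix_i r i) => c.
have <- : lincomb (A \o e) c = lincomb e (c *m (\matrix_i r i)).
  by apply: lincomb_mul => i; rewrite rowK -er.
rewrite /lincomb (big_morph A AD (_ : _ = 0)); first by apply: eq_bigr => i _; rewrite AZ.
by have := AZ 0 0; rewrite !scale0r.
Qed.

End FiniteBasis.

(** * Translations act unipotently *)

Section Nilpotent.
Variables (R : realType) (d : nat) (W : lmodType R) (G : set 'M[R]_d).
Variables (z0 : 'cV[R]_d) (V : set W) (n : nat) (b : 'I_n -> W).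
Variables (Tau : 'cV[R]_d -> W -> W) (O : 'M[R]_d -> W -> W).
Hypothesis GG : is_subgroup_GL G.
Hypothesis LG : interior (Lambda G z0) !=set0.

(** [L] is so large that [N] steps of size [h / (K * L)] from an interior point [y0] stay in a ball
    contained in [Lambda]. *)
Lemma Lambda_absorbs (h : 'cV[R]_d) (N K : nat) : (0 < K)%N ->
  exists L (y0 h' : 'cV[R]_d), h = h' *+ (K * L) /\ forall j, (j <= N)%N ->
    exists P Q, [/\ G P, G Q & y0 + h' *+ j = P *m z0 - Q *m z0].
Proof.
move=> K0; have [y0 /nbhs_ballP[e e0 yL]] := LG.
pose L := (Num.bound (N%:R * `|h| / e)).+1.
have KL0 : (0 : R) < (K * L)%:R by rewrite ltr0n muln_gt0 K0.
exists L, y0, ((K * L)%:R^-1 *: h); split.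
  by rewrite -scaler_nat scalerA mulfV ?scale1r// gt_eqF.
move=> j jN; suff /yL[P [Q [GP [GQ PQ]]]] : ball y0 e (y0 + ((K * L)%:R^-1 *: h) *+ j).
  by exists P, Q.
rewrite -ball_normE /= opprD addrA subrr add0r normrN normrMn normrZ.
rewrite normfV gtr0_norm// -[ltLHS]mulr_natl mulrCA mulrC ltr_pdivrMr//.
apply: (@le_lt_trans _ _ (N%:R * `|h|)); first by rewrite ler_wpM2r// ler_nat.
rewrite -ltr_pdivrMl// mulrC.
apply: (@lt_le_trans _ _ L%:R).
  rewrite (lt_trans (archi_boundP _))// ?ltr_nat//.
  by rewrite mulr_ge0// ?invr_ge0 ?(ltW e0).
by rewrite ler_nat leq_pmull.
Qed.

Hypothesis Vspan : forall w, V w -> exists c, w = lincomb b c.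
Hypothesis TauD : forall h, {morph Tau h : u v / u + v}.
Hypothesis TauZ : forall h a, {morph Tau h : u / a *: u}.
Hypothesis OD : forall P, {morph O P : u v / u + v}.
Hypothesis OZ : forall P a, {morph O P : u / a *: u}.
Hypothesis Tau0 : forall w, Tau 0 w = w.
Hypothesis Tau_add : forall h k w, Tau (h + k) w = Tau h (Tau k w).
Hypothesis OV : forall P w, G P -> O P (O (invmx P) w) = w.
Hypothesis OTau : forall P h w, G P -> O P (Tau h w) = Tau (invmx P *m h) (O P w).
Hypothesis VTau : forall h w, V w -> V (Tau h w).
Hypothesis VO : forall P w, G P -> V w -> V (O P w).

Lemma translations_unipotent :
  exists m, forall h w, V w -> iter m (fun u => Tau h u - u) w = 0.
Proof.
(* Square matrices form a ring only in positive size, so the zero space is set apart. *)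
have [[|m] [e [Ve ie eV]]] := finite_basis Vspan.
  exists 0%N => h w /eV[c ->]/=; rewrite /lincomb big_ord0 //.
exists m.+1 => h w /eV[c ->].
have mxP (A B : 'M[R]_m.+1) :
    (forall c, lincomb e (c *m A) = lincomb e (c *m B)) -> A = B.
  by move=> AB; apply/row_matrixP => i; rewrite !rowE; exact/ie/AB.
have /choice[M TM] k : exists D : 'M[R]_m.+1, forall c,
    Tau k (lincomb e c) = lincomb e (c *m D).
  exact: (lincomb_matrix Ve eV (TauD k) (TauZ k) (VTau k)).
have M0 : M 0 = 1 by apply: mxP => c'; rewrite -TM Tau0 mulmx1.
have MD : {morph M : x y / x + y >-> x * y}.
  (* Matrices act on row coordinates from the right, which reverses composition; commutativity of
     addition repairs the order. *)
  by move=> x y; rewrite addrC; apply: mxP => c'; rewrite mulmxA -!TM Tau_add.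
suff M1 : (M h - 1) ^+ m.+1 = 0.
  have -> k : iter k (fun u => Tau h u - u) (lincomb e c) =
      lincomb e (c *m (M h - 1) ^+ k).
    elim: k => [|k IH] /=; first by rewrite expr0 mulmx1.
    by rewrite IH TM -lincombB exprSr mulmxA mulmxBr mulmx1.
  by rewrite M1 mulmx0 lincomb0.
apply: (@matrix_rep_unipotent _ _ _ G z0) => //; last exact: Lambda_absorbs.
move=> P x GP.
have GPV : G (invmx P) by case: GG => _ [_ []] _ h1; exact: h1.
have Pu : P \in unitmx by case: GG => + _; exact.
have [D DP] := lincomb_matrix Ve eV (OD P) (OZ P) (fun w => VO GP).
have [D' DP'] := lincomb_matrix Ve eV (OD _) (OZ _) (fun w => VO GPV).
exists D.
  have /mulmx1_unit[]// : D' *m D = 1%:M.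
  by apply: mxP => c'; rewrite mulmxA -DP -DP' OV// mulmx1.
apply: mxP => c'; rewrite !mulmxA -[in RHS]DP -!TM OTau// TM DP.
by rewrite TM mulmxA mulVmx// mul1mx.
Qed.

End Nilpotent.

(** * Functions annihilated by iterated differences *)

Section Frechet1d.
Variable R : realType.
Implicit Types (u : R -> R) (t x : R) (p : {poly R}).

Definition fdiff t u : R -> R := fun x => u (x + t) - u x.

(** The binomial coefficient [X (X - 1) ... (X - j + 1) / j!] as a polynomial. *)
Definition newton_poly (j : nat) : {poly R} :=
  j`!%:R^-1 *: \prod_(i < j) ('X - i%:R%:P).

Lemma size_newton_poly j : (size (newton_poly j) <= j.+1)%N.
Proof.
apply: leq_trans (size_scale_leq _ _) _.
by rewrite size_prod_XsubC /index_enum -enumT size_enum_ord.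
Qed.

Lemma horner_newton_poly j (k : nat) : (newton_poly j).[k%:R] = 'C(k, j)%:R.
Proof.
rewrite /newton_poly hornerZ horner_prod.
have -> : \prod_(i < j) ('X - i%:R%:P : {poly R}).[k%:R] = (k ^_ j)%:R.
  elim: j => [|j IH]; first by rewrite big_ord0.
  rewrite big_ord_recr /= IH hornerXsubC ffactnSr natrM.
  have [jk|kj] := leqP j k; first by rewrite natrB.
  by rewrite ffact_small ?mul0r.
by rewrite -bin_ffact natrM mulrC mulfK// pnatr_eq0 -lt0n fact_gt0.
Qed.

(** Newton's forward formula, by Pascal's rule: the increment from [k] to [k + 1] is a value of
    [fdiff t u], which one difference fewer annihilates. *)
Lemma newton_lattice m u x0 t : (forall x, iter m (fdiff t) u x = 0) ->
  forall k : nat,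
  u (x0 + t *+ k) = \sum_(j < m) 'C(k, j)%:R * iter j (fdiff t) u x0.
Proof.
elim: m u => [|m IH] u u0 k; first by rewrite big_ord0; exact: u0.
have v0 x : iter m (fdiff t) (fdiff t u) x = 0 by rewrite -iterSr.
elim: k => [|k IHk].
  rewrite big_ord_recl bin0 mul1r mulr0n addr0 big1 ?addr0// => i _.
  by rewrite bin0n mul0r.
have -> : u (x0 + t *+ k.+1) = u (x0 + t *+ k) + fdiff t u (x0 + t *+ k).
  by rewrite /fdiff mulrSr addrA subrKC.
rewrite IHk (IH _ v0) [in RHS]big_ord_recl [X in X + _ = _]big_ord_recl !bin0.
rewrite -addrA -big_split; congr (_ + _); apply: eq_bigr => i _ /=.
by rewrite /bump /= add1n binS natrD mulrDl -iterSr.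
Qed.

Lemma poly_nat_inj p q : (forall k : nat, p.[k%:R] = q.[k%:R]) -> p = q.
Proof.
move=> pq; apply/eqP; rewrite -subr_eq0; apply/negPn/negP => pq0.
pose s : seq R := [seq k%:R | k <- iota 0 (size (p - q))].
have : (size s < size (p - q)%R)%N.
  apply: max_poly_roots => //; last first.
    by rewrite map_inj_uniq ?iota_uniq// => i j /eqP; rewrite eqr_nat => /eqP.
  apply/allP => x /mapP[k _ ->].
  by rewrite rootE hornerD hornerN pq subrr.
by rewrite size_map size_iota ltnn.
Qed.

Definition newton_interp m u : {poly R} :=
  \sum_(j < m) iter j (fdiff 1) u 0 *: newton_poly j.

Lemma size_newton_interp m u : (size (newton_interp m u) <= m)%N.
Proof.
apply: (leq_trans (size_sum _ _ _)); apply/bigmax_leqP => j _.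
apply: leq_trans (size_scale_leq _ _) (leq_trans (size_newton_poly j) _) => //.
Qed.

(** Each step [1 / (N + 1)] yields its own Newton polynomial; all of them match [u] at the natural
    numbers, hence coincide with the one of step [1]. No regularity of [u] is supposed, so that the
    result also serves for distributions. *)
Lemma newton_interp_rat m u : (forall t x, iter m (fdiff t) u x = 0) ->
  forall (z : int) (N : nat),
  u (z%:~R / N.+1%:R) = (newton_interp m u).[z%:~R / N.+1%:R].
Proof.
(* Starting at [- |z|] makes [z / (N + 1)] and every natural number reachable in a nonnegative
   number of steps. *)
move=> u0 z N; pose t : R := N.+1%:R^-1; pose x0 : R := - `|z|%N%:R.
have tN0 : t != 0 by rewrite invr_eq0 pnatr_eq0.
have tE k : t *+ k = k%:R * t by rewrite [RHS]mulr_natl.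
pose p := \sum_(j < m) iter j (fdiff t) u x0 *:
  (newton_poly j \Po (t^-1 *: ('X - x0%:P))).
have up k : u (x0 + t *+ k) = p.[x0 + t *+ k].
  rewrite (newton_lattice _ (u0 t)) horner_sum; apply: eq_bigr => j _.
  rewrite hornerZ horner_comp (hornerZ t^-1) hornerXsubC addrAC subrr add0r.
  by rewrite tE mulrCA mulVf// mulr1 horner_newton_poly mulrC.
have -> : newton_interp m u = p.
  apply: poly_nat_inj => k.
  have kE : x0 + t *+ ((k + `|z|) * N.+1) = k%:R.
    by rewrite tE natrM mulfK ?pnatr_eq0// natrD /x0 addrC addrK.
  rewrite -kE -up kE.
  have -> : k%:R = 0 + 1 *+ k :> R by rewrite add0r.
  rewrite (newton_lattice _ (u0 1)) horner_sum; apply: eq_bigr => j _.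
  by rewrite hornerZ add0r horner_newton_poly mulrC.
pose k := absz (`|z|%N%:Z * N.+1%:Z + z).
suff -> : z%:~R / N.+1%:R = x0 + t *+ k by [].
have k0 : (k%:Z = `|z|%N%:Z * N.+1%:Z + z)%R by rewrite /k gez0_abs//; clear; nia.
rewrite tE -[k%:R]/(k%:Z%:~R) k0 rmorphD rmorphM /= mulrDl mulfK ?pnatr_eq0//.
by rewrite /x0 addrA addNr add0r.
Qed.

Lemma newton_interp_continuous m u : continuous u ->
  (forall t x, iter m (fdiff t) u x = 0) ->
  forall x, u x = (newton_interp m u).[x].
Proof.
move=> cu u0 x; apply/eqP; rewrite -subr_eq0; apply/negPn/negP => g0.
pose g y := u y - (newton_interp m u).[y].
have cg : {for x, continuous g}.
  by apply: cvgB; [exact: cu|exact: continuous_horner].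
have /nbhs_ballP[e e0 ge] : nbhs x [set y | g y != 0].
  exact: (cvgr_neq0 _ cg).
have /rat_in_itvoo[q] : x - e < x + e by rewrite ltrD2l gtrN.
rewrite in_itv /= => /andP[q1 q2].
have : g (ratr q) != 0.
  by apply: ge; rewrite /ball /= distrC ltr_distl q1 q2.
rewrite /g /ratr; have := denq_gt0 q; case: (denq q) => [[//|N] _|//].
by have := newton_interp_rat u0 (numq q) N => /= ->; rewrite subrr eqxx.
Qed.

End Frechet1d.

(** * From one variable to several, for continuous functions *)

Section ContinuousCase.
Variables (R : realType) (d : nat).
Notation pt := 'cV[R]_d.
Implicit Types (f g : pt -> R) (h x : pt).

Definition fdelta h f : pt -> R := fun x => f (x + h) - f x.

Lemma fdeltaC h k f : fdelta h (fdelta k f) = fdelta k (fdelta h f).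
Proof. by apply/funext => x; rewrite /fdelta (addrAC x h k); ring. Qed.

Lemma iter_fdeltaC i j h k f :
  iter i (fdelta h) (iter j (fdelta k) f) = iter j (fdelta k) (iter i (fdelta h) f).
Proof.
elim: i => //= i ->; elim: j => //= j IH.
by rewrite fdeltaC IH.
Qed.

Lemma iter_fdelta0 j h : iter j (fdelta h) (fun=> 0) = (fun=> 0).
Proof. by elim: j => //= j ->; apply/funext => x; rewrite /fdelta subrr. Qed.

Lemma addl_continuous h : continuous (fun y : pt => y + h).
Proof. by move=> x; exact: (@cvgD R _ _ (nbhs x) _ id (cst h) _ _ cvg_id (cvg_cst _)). Qed.

Lemma line_continuous x h : continuous (fun s : R => x + s *: h).
Proof.
move=> s; apply: (@continuousD R pt R (cst x) (fun s => s *: h)).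
  exact: cst_continuous.
exact: scalel_continuous.
Qed.

Lemma continuous_fdelta h f : continuous f -> continuous (fdelta h f).
Proof.
move=> cf x; apply: continuousB; last exact: cf.
by apply: (@continuous_comp pt pt R (fun y => y + h) f x); [exact: addl_continuous|exact: cf].
Qed.

Lemma iter_fdiff_line j t f x h s :
  iter j (fdiff t) (fun s => f (x + s *: h)) s = iter j (fdelta (t *: h)) f (x + s *: h).
Proof.
by elim: j s => //= j IH s; rewrite /fdiff /fdelta !IH scalerDl addrA.
Qed.

Lemma is_poly_cst (a : R) : is_poly_fun (fun _ : pt => a).
Proof.
exists 1%N, (fun=> a), (fun _ _ => 0%N) => x.
by rewrite big_ord1 big1 ?mulr1// => i _; rewrite expr0.
Qed.

Lemma is_polyD f g : is_poly_fun f -> is_poly_fun g -> is_poly_fun (fun x => f x + g x).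
Proof.
move=> [n [c [a fE]]] [m [c' [a' gE]]].
exists (n + m)%N, (fun k => match fintype.split k with inl i => c i | inr j => c' j end),
  (fun k => match fintype.split k with inl i => a i | inr j => a' j end) => x.
rewrite fE gE big_split_ord /=; congr (_ + _); apply: eq_bigr => k _.
  by rewrite -[lshift m k]/(unsplit (inl k)) unsplitK.
by rewrite -[rshift n k]/(unsplit (inr k)) unsplitK.
Qed.

Lemma is_polyZ b f : is_poly_fun f -> is_poly_fun (fun x => b * f x).
Proof.
move=> [n [c [a fE]]]; exists n, (fun k => b * c k), a => x.
by rewrite fE mulr_sumr; apply: eq_bigr => k _; rewrite mulrA.
Qed.

Lemma is_polyX i f : is_poly_fun f -> is_poly_fun (fun x => x i 0 * f x).
Proof.
move=> [n [c [a fE]]]; exists n, c, (fun k j => (j == i) + a k j)%N => x.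
rewrite fE mulr_sumr; apply: eq_bigr => k _; rewrite mulrCA; congr (_ * _).
rewrite [in RHS](bigD1 i)//= eqxx add1n exprS -mulrA; congr (_ * _).
rewrite (bigD1 i)//=; congr (_ * _); apply: eq_bigr => j /negPf ->.
by rewrite add0n.
Qed.

Lemma is_poly_sum (I : Type) (r : seq I) (F : I -> pt -> R) :
  (forall j, is_poly_fun (F j)) -> is_poly_fun (fun x => \sum_(j <- r) F j x).
Proof.
move=> FP; elim: r => [|j r IH].
  by under [X in is_poly_fun X]eq_fun do rewrite big_nil; exact: is_poly_cst.
under [X in is_poly_fun X]eq_fun do rewrite big_cons.
exact: is_polyD.
Qed.

Lemma is_polyM1 i (p : {poly R}) f :
  is_poly_fun f -> is_poly_fun (fun x => p.[x i 0] * f x).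
Proof.
move=> fP; elim/poly_ind: p => [|p c IH].
  by under [X in is_poly_fun X]eq_fun do rewrite horner0 mul0r; exact: is_poly_cst.
under [X in is_poly_fun X]eq_fun => x do
  rewrite hornerMXaddC mulrDl -mulrA mulrCA.
by apply: is_polyD; [exact: is_polyX|exact: is_polyZ].
Qed.

Definition trunc_coord (k : nat) (x : pt) : pt :=
  \col_i (if (i < k)%N then x i 0 else 0).

Lemma trunc_coordS (k : 'I_d) x :
  trunc_coord k.+1 x = trunc_coord k x + x k 0 *: ebasis R k.
Proof.
apply/colP => i; rewrite !mxE eqxx andbT ltnS leq_eqVlt.
have [->|ik] := eqVneq i k; first by rewrite eqxx ltnn mulr1 add0r.
by rewrite mulr0 addr0 (_ : (i == k :> nat) = false)//; apply/negbTE.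
Qed.

(** In the last retained coordinate, the Newton coefficients are differences of [g] along [e]. These
    are again continuous and annihilated by [m]-fold differences, which is why [H] ranges over all
    [g]. *)
Lemma fdelta_nilpotent_poly m f : continuous f ->
  (forall h x, iter m (fdelta h) f x = 0) -> is_poly_fun f.
Proof.
move=> cf f0.
suff H k : (k <= d)%N -> forall g, continuous g ->
    (forall h x, iter m (fdelta h) g x = 0) ->
    is_poly_fun (g \o trunc_coord k).
  have := H d (leqnn d) f cf f0; congr is_poly_fun.
  apply/funext => x /=; congr f; apply/colP => i.
  by rewrite mxE ltn_ord.
elim: k => [|k IH] kd g cg g0.
  have -> : g \o trunc_coord 0 = fun=> g 0.
    by apply/funext => x /=; congr g; apply/colP => i; rewrite !mxE.
  exact: is_poly_cst.
pose e := ebasis R (Ordinal kd).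
have -> : g \o trunc_coord k.+1 = fun x => \sum_(j < m)
    (newton_poly R j).[x (Ordinal kd) 0] *
    (iter j (fdelta e) g \o trunc_coord k) x.
  apply/funext => x /=; rewrite (trunc_coordS (Ordinal kd)) /=.
  rewrite (@newton_interp_continuous _ m
    (fun s => g (trunc_coord k x + s *: e))).
  - rewrite horner_sum; apply: eq_bigr => j _; rewrite hornerZ mulrC.
    by rewrite iter_fdiff_line scale1r scale0r addr0.
  - move=> s; apply: (@continuous_comp R pt R (fun s => _ + s *: e) g s); last exact: cg.
    exact: line_continuous.
  - by move=> t s; rewrite iter_fdiff_line g0.
apply: is_poly_sum => j; apply: is_polyM1; apply: IH; first exact: ltnW.
  by elim: (nat_of_ord j) => //= i; exact: continuous_fdelta.
move=> h x; rewrite iter_fdeltaC.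
have -> : iter m (fdelta h) g = fun=> 0 by apply/funext => y; rewrite g0.
by rewrite iter_fdelta0.
Qed.

Theorem continuous_case (G : set 'M[R]_d) (V : set (pt -> R)) (z0 : pt) :
    is_subgroup_GL G -> fdim_subspace_C V -> interior (Lambda G z0) !=set0 ->
    (forall h f, V f -> V (ftau h f)) ->
    (forall P f, G P -> V f -> V (fO P f)) ->
  forall f, V f -> is_poly_fun f.
Proof.
move=> GG [Vc [V0 [VD [VZ [n [b Vb]]]]]] LG VT VO f Vf.
have [|||||||||||m fm] := @translations_unipotent R d (pt -> R) G z0 V n b
  (@ftau R d) (@fO R d) GG LG; last first.
- apply: (@fdelta_nilpotent_poly m); first exact: Vc.
  by move=> h x; rewrite (_ : iter m (fdelta h) f = 0)//; exact: fm.
- exact: VO.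
- exact: VT.
- move=> P h w GP; apply/funext => x; rewrite /fO /ftau mulmxDr mulmxA.
  by rewrite mulmxV ?mul1mx//; case: GG => + _; exact.
- move=> P w GP; apply/funext => x; rewrite /fO mulmxA.
  by rewrite mulVmx ?mul1mx//; case: GG => + _; exact.
- by move=> h k w; apply/funext => x; rewrite /ftau addrA.
- by move=> w; apply/funext => x; rewrite /ftau addr0.
- by [].
- by [].
- by [].
- by [].
- move=> w /Vb[c wE]; exists (\row_i c i); apply/funext => x.
  rewrite wE /lincomb fct_sumE; apply: eq_bigr => i _; rewrite mxE //.
Qed.

End ContinuousCase.

(** * Smooth functions *)

Section DirectionalDerivative.
Variables (R : realType) (U : normedModType R).
Implicit Types (f : U -> R) (x v : U) (l : R).

Lemma is_deriveP f x v l : is_derive x v f l <->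
  h^-1 * (f (x + h *: v) - f x) @[h --> 0^'] --> l.
Proof.
have E : (fun h : R => h^-1 *: ((f \o shift x) (h *: v) - f x)) =
    (fun h => h^-1 * (f (x + h *: v) - f x)).
  by apply/funext => h /=; rewrite [_ + x]addrC.
split=> [[df dE]|cf].
  by rewrite -E -dE; exact: df.
apply: DeriveDef; first by rewrite /derivable E; exact: cvgP cf.
by rewrite /derive E; exact: cvg_lim.
Qed.

End DirectionalDerivative.

Section DirectionalDerivativeLine.
Variables (R : realType) (U : normedModType R).
Implicit Types (f : U -> R) (x v : U) (l : R).

Lemma is_derive_line f x v l s :
  is_derive (x + s *: v) v f l -> is_derive s 1 (fun t => f (x + t *: v)) l.
Proof.
move=> /is_deriveP cf; apply/is_deriveP.
suff -> : (fun h : R => h^-1 * (f (x + (s + h *: 1) *: v) - f (x + s *: v))) =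
  (fun h => h^-1 * (f (x + s *: v + h *: v) - f (x + s *: v))) by [].
by apply/funext => h; rewrite -[h *: 1]/(h * 1) mulr1 scalerDl addrA.
Qed.

(* Smooth functions with bounded derivatives satisfy such a bound, which also survives
   integration over a parameter. *)
Lemma is_derive_quadratic f x v l C :
  (forall h, `|f (x + h *: v) - f x - h * l| <= C * h ^+ 2) -> is_derive x v f l.
Proof.
move=> fC; apply/is_deriveP/cvgrPdist_le => e e0.
pose M := `|C| + 1; have M0 : 0 < M by rewrite ltr_pwDr.
near=> h.
have h0 : h != 0 by near: h; exact: nbhs_dnbhs_neq.
rewrite distrC -(ler_pM2l (_ : 0 < `|h|)) ?normr_gt0// -normrM mulrBr mulrA mulfV// mul1r.
apply: (le_trans (fC h)); rewrite -real_normK ?num_real// expr2 mulrA mulrC.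
rewrite ler_wpM2l//; apply: (@le_trans _ _ (M * `|h|)).
  by rewrite ler_wpM2r// (le_trans (ler_norm _))// lerDl.
rewrite mulrC -ler_pdivlMr//.
near: h; apply: dnbhs0_le; exact: divr_gt0.
Unshelve. all: by end_near. Qed.

End DirectionalDerivativeLine.

Section Smooth.
Variables (R : realType) (d : nat).
Notation pt := 'cV[R]_d.
Notation e_ := (@ebasis R d).
Implicit Types (f g : pt -> R) (x y : pt) (i j : 'I_d).

Lemma coord_le_norm x i : `|x i 0| <= `|x|.
Proof.
rewrite [leRHS]/Num.Def.normr /= mx_normrE; apply/bigmax_geP; right => /=.
by exists (i, 0).
Qed.

Lemma norm_le_coord x (M : R) : 0 <= M -> (forall i, `|x i 0| <= M) -> `|x| <= M.
Proof.
move=> M0 xM; rewrite [leLHS]/Num.Def.normr /= mx_normrE; apply/bigmax_leP.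
by split=> // -[i j] _ /=; rewrite (ord1 j).
Qed.

Lemma norm_ebasis i : `|e_ i| <= 1.
Proof.
apply: norm_le_coord => // j; rewrite mxE eqxx andbT.
by case: eqP => _; rewrite ?normr1 ?normr0.
Qed.

Definition pd i f : pt -> R := fun x => 'D_(e_ i) f x.

Definition pdiff f := forall i x, derivable f x (e_ i).

Lemma pdiffP f i x : pdiff f -> is_derive x (e_ i) f (pd i f x).
Proof. by move=> df; exact/derivableP. Qed.

Lemma pdE f i g : (forall x, is_derive x (e_ i) f (g x)) -> pd i f = g.
Proof. by move=> fg; apply/funext => x; exact: (@derive_val _ _ _ _ _ _ _ (fg x)). Qed.

(** Writing the mean value point as a fraction [t] of [s] treats both signs of [s] at once. *)
Lemma line_MVT f x i s : pdiff f ->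
  exists2 t, 0 <= t <= 1 & f (x + s *: e_ i) - f x = s * pd i f (x + (t * s) *: e_ i).
Proof.
move=> df.
have dl (t : R) : is_derive t 1 (fun t => f (x + (t * s) *: e_ i))
    (pd i f (x + (t * s) *: e_ i) * s).
  apply: (@is_derive1_comp _ (fun t => f (x + t *: e_ i)) ( *%R^~ s)).
    exact/is_derive_line/pdiffP.
  apply: (@is_derive_quadratic _ _ _ _ _ _ 0) => h.
  by rewrite -[h *: 1]/(h * 1) mul0r normr_le0; apply/eqP; ring.
have cl : {within `[0, 1], continuous (fun t => f (x + (t * s) *: e_ i))}.
  apply: continuous_subspaceT => t.
  by apply: differentiable_continuous; apply/derivable1_diffP; case: (dl t).
have [u] := MVT_segment ler01 (fun t _ => dl t) cl.
rewrite in_itv /= => u01; rewrite mul0r scale0r addr0 mul1r subr0 mulr1 => E.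
by exists u => //; rewrite E mulrC.
Qed.

Definition bounded f := exists C : R, forall x, `|f x| <= C.

Lemma bounded_ge0 f : bounded f -> exists2 C : R, 0 <= C & forall x, `|f x| <= C.
Proof. by move=> [C fC]; exists C => //; exact: le_trans (fC 0). Qed.

(** The coordinates of [x] are replaced by those of [y] one at a time, each with its own mean value,
    so that only partial derivatives enter. In the max norm the intermediate points stay as close to
    [x] as [y] is. *)
Lemma multi_MVT f x y : pdiff f -> exists xi : 'I_d -> pt,
  (forall i, `|xi i - x| <= `|y - x|) /\
  f y - f x = \sum_i (y i 0 - x i 0) * pd i f (xi i).
Proof.
move=> df; pose z k : pt := \col_i (if (i < k)%N then y i 0 else x i 0).
have zS i : z i.+1 = z i + (y i 0 - x i 0) *: e_ i.
  apply/colP => j; rewrite !mxE eqxx andbT ltnS leq_eqVlt.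
  have [->|ij] := eqVneq j i; first by rewrite eqxx ltnn mulr1 addrC subrK.
  by rewrite mulr0 addr0 (_ : (j == i :> nat) = false)//; apply/negbTE.
have /choice[t tP] i : exists t, 0 <= t <= 1 /\
    f (z i.+1) - f (z i) = (y i 0 - x i 0) * pd i f (z i + (t * (y i 0 - x i 0)) *: e_ i).
  by have [t t01 tE] := line_MVT (z i) i (y i 0 - x i 0) df; exists t; rewrite zS.
exists (fun i => z i + (t i * (y i 0 - x i 0)) *: e_ i); split=> [i|].
  apply: norm_le_coord => // j; rewrite !mxE eqxx andbT.
  have [->|ij] := eqVneq j i.
    have [/andP[t0 t1] _] := tP i.
    rewrite ltnn mulr1 addrAC subrr add0r normrM ger0_norm//.
    rewrite -[leRHS]mul1r ler_pM//.
    by have := coord_le_norm (y - x) i; rewrite !mxE.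
  rewrite mulr0 addr0; case: ifP => _; last by rewrite subrr normr0.
  by have := coord_le_norm (y - x) j; rewrite !mxE.
have -> : y = z d by apply/colP => i; rewrite mxE ltn_ord.
have -> : x = z 0%N by apply/colP => i; rewrite mxE.
rewrite -(telescope_sumr (fun k => f (z k)) (leq0n d)) big_mkord.
apply: eq_bigr => i _; rewrite (tP i).2.
by rewrite !mxE ltn_ord.
Qed.

Lemma bounded_pd_lipschitz f : pdiff f -> (forall i, bounded (pd i f)) ->
  exists2 L : R, 0 <= L & forall x y, `|f y - f x| <= L * `|y - x|.
Proof.
move=> df bf; have /choice[C CP] i : exists C : R, 0 <= C /\ forall x, `|pd i f x| <= C.
  by have [C C0 fC] := bounded_ge0 (bf i); exists C.
exists (\sum_i C i); first by apply: sumr_ge0 => i _; case: (CP i).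
move=> x y; have [xi [_ ->]] := multi_MVT x y df.
rewrite mulr_suml (le_trans (ler_norm_sum _ _ _))//.
apply: ler_sum => i _; rewrite normrM mulrC ler_pM//; first by case: (CP i).
by have := coord_le_norm (y - x) i; rewrite !mxE.
Qed.

Lemma lipschitz_continuous f (L : R) :
  (forall x y, `|f y - f x| <= L * `|y - x|) -> continuous f.
Proof.
move=> fL x; apply/(@cvgrPdist_le _ _ _ (nbhs x)) => e e0.
have M0 : 0 < `|L| + 1 by rewrite ltr_pwDr.
apply/nbhs_ballP; exists (e / (`|L| + 1)) => /= [|y]; first exact: divr_gt0.
rewrite -ball_normE /= => xy; rewrite distrC (le_trans (fL _ _))//.
apply: (@le_trans _ _ ((`|L| + 1) * `|y - x|)).
  by rewrite ler_wpM2r// (le_trans (ler_norm _))// lerDl.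
by rewrite mulrC -ler_pdivlMr// distrC ltW.
Qed.

(** The bounds give Lipschitz and quadratic estimates uniform in the point, and thereby continuity
    of all derivatives. Unlike compact support, boundedness survives integration along an axis. *)
Definition bsmooth f :=
  forall s : seq 'I_d, pdiff (dseq s f) /\ bounded (dseq s f).

(** Coinduction: for a family closed under partial derivatives, a single differentiation suffices,
    without formulas for the iterated ones. *)
Lemma bsmooth_coind (S : (pt -> R) -> Prop) :
    (forall f, S f -> bounded f /\
       forall i, exists2 g, S g & forall x, is_derive x (e_ i) f (g x)) ->
  forall f, S f -> bsmooth f.
Proof.
move=> SP f Sf s; have : S (dseq s f).
  elim: s => //= i s /SP[_ /(_ i)[g Sg]] /pdE.
  by rewrite /pd => ->.
move=> /SP[bs ds]; split=> // i x.
by have [g _ /(_ x)[]] := ds i.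
Qed.

Lemma bsmooth_pdiff f : bsmooth f -> pdiff f.
Proof. by move=> /(_ [::])[]. Qed.

Lemma bsmooth_bounded f : bsmooth f -> bounded f.
Proof. by move=> /(_ [::])[]. Qed.

Lemma dseq_rcons s i f : dseq (rcons s i) f = dseq s (pd i f).
Proof. by rewrite /dseq foldr_rcons. Qed.

Lemma bsmooth_pd f i : bsmooth f -> bsmooth (pd i f).
Proof. by move=> bf s; rewrite -dseq_rcons; exact: bf. Qed.

Lemma bsmooth_dseq f s : bsmooth f -> bsmooth (dseq s f).
Proof. by move=> bf; elim: s => //= i s; exact: bsmooth_pd. Qed.

Lemma bsmooth_lipschitz f : bsmooth f ->
  exists2 L : R, 0 <= L & forall x y, `|f y - f x| <= L * `|y - x|.
Proof.
move=> bf; apply: bounded_pd_lipschitz; first exact: bsmooth_pdiff.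
by move=> i; exact/bsmooth_bounded/bsmooth_pd.
Qed.

Lemma bsmooth_continuous f : bsmooth f -> continuous f.
Proof. by move=> /bsmooth_lipschitz[L _]; exact: lipschitz_continuous. Qed.

Lemma bsmooth_smooth f : bsmooth f -> smooth f.
Proof.
move=> bf s; split; first exact/bsmooth_continuous/bsmooth_dseq.
by case: (bf s).
Qed.

Lemma bsmooth_derive f i x : bsmooth f -> is_derive x (e_ i) f (pd i f x).
Proof. by move=> /bsmooth_pdiff; exact: pdiffP. Qed.

Lemma bsmooth_taylor f i : bsmooth f -> exists2 C : R, 0 <= C &
  forall x s, `|f (x + s *: e_ i) - f x - s * pd i f x| <= C * s ^+ 2.
Proof.
move=> bf; have [L L0 fL] := bsmooth_lipschitz (bsmooth_pd i bf).
exists L => // x s; have [t /andP[t0 t1] ->] := line_MVT x i s (bsmooth_pdiff bf).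
rewrite -mulrBr normrM (le_trans (ler_wpM2l _ (fL _ _)))// addrAC subrr add0r.
rewrite normrZ mulrCA ler_wpM2l// -real_normK ?num_real// expr2 ler_wpM2l//.
rewrite normrM (ger0_norm t0) -mulrA -[leRHS]mul1r ler_pM//.
by rewrite -[leRHS]mulr1 ler_wpM2l// norm_ebasis.
Qed.

End Smooth.

(** * Closure properties of smooth functions and test functions; symmetry of mixed derivatives *)

Section SmoothClosure.
Variables (R : realType) (d : nat).
Notation pt := 'cV[R]_d.
Notation e_ := (@ebasis R d).
Implicit Types (f g : pt -> R) (x y b : pt) (i j : 'I_d) (A : 'M[R]_d).

Lemma mulmx_ebasis A j : A *m e_ j = col j A.
Proof. by rewrite /ebasis colE. Qed.

(** The mean value points lie within [|h v|] of [A x + b], and the partial derivatives of [f] are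
    Lipschitz; this gives the chain rule with a remainder of order [h ^ 2]. *)
Lemma is_derive_affine f A b x j : bsmooth f ->
  is_derive x (e_ j) (fun x => f (A *m x + b))
    (\sum_i A i j * pd i f (A *m x + b)).
Proof.
move=> bf; pose v := col j A; pose z := A *m x + b.
have /choice[L LP] i : exists L : R, 0 <= L /\
    forall x y, `|pd i f y - pd i f x| <= L * `|y - x|.
  by have [L L0 fL] := bsmooth_lipschitz (bsmooth_pd i bf); exists L.
apply: (@is_derive_quadratic _ _ _ _ _ _ (\sum_i `|v i 0| * L i * `|v|)) => h.
have -> : A *m (x + h *: e_ j) + b = z + h *: v.
  by rewrite mulmxDr -scalemxAr mulmx_ebasis addrAC.
have [xi [xiP ->]] := multi_MVT z (z + h *: v) (bsmooth_pdiff bf).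
rewrite mulr_sumr -sumrB mulr_suml (le_trans (ler_norm_sum _ _ _))//.
apply: ler_sum => i _.
have -> : (z + h *: v) i 0 - z i 0 = h * v i 0.
  by rewrite [(z + _) i 0]mxE [(h *: v) i 0]mxE; ring.
have -> : A i j = v i 0 by rewrite mxE.
rewrite -/z (_ : _ - _ = h * (v i 0 * (pd i f (xi i) - pd i f z))); last by ring.
rewrite !normrM.
have xih := xiP i; rewrite addrAC subrr add0r normrZ in xih.
apply: (@le_trans _ _ (`|h| * (`|v i 0| * (L i * (`|h| * `|v|))))).
  rewrite ler_wpM2l// ler_wpM2l// (le_trans ((LP i).2 _ _))//.
  by rewrite ler_wpM2l//; case: (LP i).
by rewrite -[h ^+ 2]real_normK ?num_real// le_eqVlt; apply/orP; left; apply/eqP; ring.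
Qed.

(** Derivatives of products are sums of products, and those of affine substitutions are combinations
    of substitutions; [bsmooth_coind] needs one class closed under all of these. *)
Inductive smooth_alg : (pt -> R) -> Prop :=
| smooth_alg_base f of bsmooth f : smooth_alg f
| smooth_alg_cst (a : R) : smooth_alg (fun=> a)
| smooth_algD f g of smooth_alg f & smooth_alg g : smooth_alg (fun x => f x + g x)
| smooth_algM f g of smooth_alg f & smooth_alg g : smooth_alg (fun x => f x * g x)
| smooth_alg_affine f A b of bsmooth f : smooth_alg (fun x => f (A *m x + b)).

Lemma smooth_alg_sum n (F : 'I_n -> pt -> R) :
  (forall k, smooth_alg (F k)) -> smooth_alg (fun x => \sum_k F k x).
Proof.
elim: n F => [|n IH] F FP.
  by under eq_fun do rewrite big_ord0; exact: smooth_alg_cst.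
under eq_fun do rewrite big_ord_recl.
by apply: smooth_algD => //; exact: IH.
Qed.

Lemma smooth_alg_bsmooth f : smooth_alg f -> bsmooth f.
Proof.
apply: bsmooth_coind => {}f; elim=> {f}.
- move=> f bf; split; first exact: bsmooth_bounded.
  move=> i; exists (pd i f); first exact/smooth_alg_base/bsmooth_pd.
  by move=> x; exact: bsmooth_derive.
- move=> a; split; first by exists `|a|.
  by move=> i; exists (fun=> 0); [exact: smooth_alg_cst|move=> x; exact: is_derive_cst].
- move=> f g _ [[C fC] df] _ [[D gD] dg]; split.
    by exists (C + D) => x; rewrite (le_trans (ler_normD _ _))// lerD.
  move=> i; have [f' sf' ff'] := df i; have [g' sg' gg'] := dg i.
  by exists (fun x => f' x + g' x) => [|x]; [exact: smooth_algD|exact: is_deriveD].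
- move=> f g sf [[C fC] df] sg [[D gD] dg]; split.
    by exists (C * D) => x; rewrite normrM ler_pM.
  move=> i; have [f' sf' ff'] := df i; have [g' sg' gg'] := dg i.
  exists (fun x => f x * g' x + g x * f' x) => [|x]; last exact: is_deriveM.
  by apply: smooth_algD; exact: smooth_algM.
- move=> f A b bf; split.
    by have [C fC] := bsmooth_bounded bf; exists C.
  move=> j; exists (fun x => \sum_i A i j * pd i f (A *m x + b)).
    apply: smooth_alg_sum => i; apply: smooth_algM; first exact: smooth_alg_cst.
    exact/smooth_alg_affine/bsmooth_pd.
  by move=> x; exact: is_derive_affine.
Qed.

Lemma bsmooth_cst (a : R) : bsmooth (fun _ : pt => a).
Proof. exact/smooth_alg_bsmooth/smooth_alg_cst. Qed.

Lemma bsmoothD f g : bsmooth f -> bsmooth g -> bsmooth (fun x => f x + g x).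
Proof.
by move=> bf bg; apply/smooth_alg_bsmooth/smooth_algD; exact: smooth_alg_base.
Qed.

Lemma bsmoothM f g : bsmooth f -> bsmooth g -> bsmooth (fun x => f x * g x).
Proof.
by move=> bf bg; apply/smooth_alg_bsmooth/smooth_algM; exact: smooth_alg_base.
Qed.

Lemma bsmoothZ (a : R) f : bsmooth f -> bsmooth (fun x => a * f x).
Proof. exact/bsmoothM/bsmooth_cst. Qed.

Lemma bsmooth_affine f A b : bsmooth f -> bsmooth (fun x => f (A *m x + b)).
Proof. by move=> bf; exact/smooth_alg_bsmooth/smooth_alg_affine. Qed.

Lemma pdD f g i : bsmooth f -> bsmooth g ->
  pd i (fun x => f x + g x) = (fun x => pd i f x + pd i g x).
Proof. by move=> bf bg; apply: pdE => x; apply: is_deriveD; exact: bsmooth_derive. Qed.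

Lemma pdM f g i : bsmooth f -> bsmooth g ->
  pd i (fun x => f x * g x) = (fun x => f x * pd i g x + g x * pd i f x).
Proof. by move=> bf bg; apply: pdE => x; apply: is_deriveM; exact: bsmooth_derive. Qed.

Lemma pd_cst (a : R) i : pd i (fun _ : pt => a) = fun=> 0.
Proof. by apply: pdE => x; exact: is_derive_cst. Qed.

Lemma pdZ (a : R) f i : bsmooth f -> pd i (fun x => a * f x) = (fun x => a * pd i f x).
Proof.
move=> bf; rewrite pdM//; last exact: bsmooth_cst.
by apply/funext => x; rewrite pd_cst mulr0 addr0.
Qed.

Lemma pdB f g i : bsmooth f -> bsmooth g ->
  pd i (fun x => f x - g x) = (fun x => pd i f x - pd i g x).
Proof. by move=> bf bg; apply: pdE => x; apply: is_deriveB; exact: bsmooth_derive. Qed.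

Lemma bsmoothB f g : bsmooth f -> bsmooth g -> bsmooth (fun x => f x - g x).
Proof.
move=> bf bg; rewrite (_ : (fun x => _) = (fun x => f x + -1 * g x)).
  exact/bsmoothD/bsmoothZ.
by apply/funext => x; rewrite mulN1r.
Qed.

Lemma pd_affine f A b j : bsmooth f ->
  pd j (fun x => f (A *m x + b)) = fun x => \sum_i A i j * pd i f (A *m x + b).
Proof. by move=> bf; apply: pdE => x; exact: is_derive_affine. Qed.

Lemma pd_translate f b i : bsmooth f ->
  pd i (fun x => f (x + b)) = fun x => pd i f (x + b).
Proof.
move=> bf; have := pd_affine 1%:M b i bf.
have -> : (fun x => f (1%:M *m x + b)) = fun x => f (x + b).
  by apply/funext => x; rewrite mul1mx.
move=> ->; apply/funext => x; rewrite mul1mx (bigD1 i)//= mxE eqxx mul1r.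
by rewrite big1 ?addr0// => j ji; rewrite mxE (negPf ji) mul0r.
Qed.

Lemma bsmooth_translate f b : bsmooth f -> bsmooth (fun x => f (x + b)).
Proof.
move=> bf; have := bsmooth_affine 1%:M b bf.
by congr bsmooth; apply/funext => x; rewrite mul1mx.
Qed.

Lemma pd_eq0 (P : pt -> Prop) f j :
    (forall x, P x -> exists2 e : R, 0 < e & forall h, `|h| < e -> P (x + h *: e_ j)) ->
    (forall x, P x -> f x = 0) ->
  forall x, P x -> pd j f x = 0.
Proof.
move=> Pop f0 x Px; suff D0 : is_derive x (e_ j) f 0 by exact: derive_val.
apply/is_deriveP; apply: cvg_near_cst.
have [e e0 eP] := Pop x Px.
near=> h; rewrite !f0 ?subrr ?mulr0//; apply: eP.
by near: h; exact: dnbhs0_lt.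
Unshelve. all: by end_near. Qed.

(** Boundedness of the support in one direction only: a bump function of [x_i] alone, or a function
    already integrated along other axes, need not have bounded support. *)
Definition supc i (M : R) f := forall x, M < `|x i 0| -> f x = 0.

Lemma supc_pd i j M f : supc i M f -> supc i M (pd j f).
Proof.
move=> sf; apply: pd_eq0 => // x Mx.
exists (`|x i 0| - M); first by rewrite subr_gt0.
move=> h hM; rewrite mxE.
have : `|(h *: e_ j) i 0| <= `|h|.
  by rewrite mxE normrM -[leRHS]mulr1 ler_wpM2l// (le_trans (coord_le_norm _ _))// norm_ebasis.
move: ((h *: e_ j) i 0) => k kh.
have := ler_distD 0 (x i 0) (- k); rewrite subr0 sub0r normrN opprK normrN.
have := ler_normD (x i 0 + k) (- k); rewrite addrK normrN.
lra.
Qed.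

Lemma supp_in_ball_pd M j f : supp_in_ball M f -> supp_in_ball M (pd j f).
Proof.
move=> sf; apply: pd_eq0 => // x Mx.
exists (`|x| - M); first by rewrite subr_gt0.
move=> h hM; have := ler_normD (x + h *: e_ j) (- (h *: e_ j)); rewrite addrK normrN.
have : `|h *: e_ j| <= `|h| by rewrite normrZ -[leRHS]mulr1 ler_wpM2l// norm_ebasis.
lra.
Qed.

Lemma supp_in_ball_dseq M s f : supp_in_ball M f -> supp_in_ball M (dseq s f).
Proof. by move=> sf; elim: s => //= i s; exact: supp_in_ball_pd. Qed.

Lemma supp_bounded M f : continuous f -> supp_in_ball M f -> bounded f.
Proof.
(* The transposition leads to row vectors, to which [bounded_closed_compact] applies. *)
move=> cf sf; pose g (v : 'rV[R]_d) := f v^T.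
have trn (v w : 'rV[R]_d) : `|v^T - w^T| <= `|v - w|.
  apply: norm_le_coord => // i; rewrite !mxE.
  rewrite [leRHS]/Num.Def.normr /= mx_normrE; apply/bigmax_geP; right => /=.
  by exists (0, i); rewrite //= !mxE.
have cg : continuous g.
  move=> v; apply: (@continuous_comp _ pt R (fun v => v^T) f v); last exact: cf.
  apply/(@cvgrPdist_le _ _ _ (nbhs v)) => e e0.
  apply/nbhs_ballP; exists e => //= w; rewrite -ball_normE /= => vw.
  by rewrite (le_trans (trn _ _))// ltW.
pose K : set 'rV[R]_d := [set v | `|v| <= M].
have cK : compact K.
  apply: bounded_closed_compact.
    exists M; split; first exact: num_real.
    by move=> N MN v /= vM; rewrite (le_trans vM)// ltW.
  apply: (@closed_comp _ _ (fun v : 'rV[R]_d => `|v|) [set x | x <= M]).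
    by move=> v _; exact: norm_continuous.
  exact: closed_le.
have : compact (g @` K).
  by apply: continuous_compact => //; exact: continuous_subspaceT.
move=> /compact_bounded[N [_ NP]].
exists (`|N| + 1) => x; have [xM|/sf->] := leP `|x| M; last first.
  by rewrite normr0 addr_ge0.
apply: NP; first by rewrite (le_lt_trans (ler_norm _))// ltrDl.
exists x^T; last by rewrite /g trmxK.
rewrite /K /=; apply: le_trans xM.
rewrite [leLHS]/Num.Def.normr /= mx_normrE.
apply/bigmax_leP; split=> // -[i j] _ /=.
by rewrite mxE (ord1 i); exact: coord_le_norm.
Qed.

Lemma test_fun_bsmooth f : test_fun f -> bsmooth f.
Proof.
move=> [sf [M fM]] s; split.
  by move=> i x; case: (sf s) => _; exact.
apply: (@supp_bounded M); first by case: (sf s).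
exact: supp_in_ball_dseq.
Qed.

Lemma test_funP f : test_fun f <-> bsmooth f /\ exists M, supp_in_ball M f.
Proof.
split=> [tf|[bf sf]]; first by split; [exact: test_fun_bsmooth|case: tf].
by split=> //; exact: bsmooth_smooth.
Qed.

Lemma test_fun0 : test_fun (fun _ : pt => 0).
Proof. by apply/test_funP; split; [exact: bsmooth_cst|exists 0]. Qed.

Lemma test_funMl f g : bsmooth f -> test_fun g -> test_fun (fun x => f x * g x).
Proof.
move=> bf /test_funP[bg [M gM]]; apply/test_funP; split; first exact: bsmoothM.
by exists M => x /gM ->; rewrite mulr0.
Qed.

Lemma test_funZ (a : R) f : test_fun f -> test_fun (fun x => a * f x).
Proof. exact/test_funMl/bsmooth_cst. Qed.

Lemma test_funD f g : test_fun f -> test_fun g -> test_fun (fun x => f x + g x).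
Proof.
move=> /test_funP[bf [M fM]] /test_funP[bg [N gN]]; apply/test_funP.
split; first exact: bsmoothD.
by exists (Num.max M N) => x; rewrite gt_max => /andP[/fM-> /gN->]; rewrite addr0.
Qed.

Lemma test_funB f g : test_fun f -> test_fun g -> test_fun (fun x => f x - g x).
Proof.
move=> tf tg; rewrite (_ : (fun x => _) = (fun x => f x + -1 * g x)).
  exact/test_funD/test_funZ.
by apply/funext => x; rewrite mulN1r.
Qed.

Lemma test_fun_pd i f : test_fun f -> test_fun (pd i f).
Proof.
move=> /test_funP[bf [M fM]]; apply/test_funP; split; first exact: bsmooth_pd.
by exists M; exact: supp_in_ball_pd.
Qed.

Lemma test_fun_translate f b : test_fun f -> test_fun (fun x => f (x + b)).
Proof.
move=> /test_funP[bf [M fM]]; apply/test_funP; split; first exact: bsmooth_translate.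
exists (M + `|b|) => x Mx; apply: fM.
by have := ler_normD (x + b) (- b); rewrite addrK normrN; lra.
Qed.

Lemma norm_mulmx A : exists2 C : R, 0 <= C & forall x, `|A *m x| <= C * `|x|.
Proof.
exists (\sum_i \sum_j `|A i j|); first by rewrite sumr_ge0// => i _; rewrite sumr_ge0.
move=> x; apply: norm_le_coord => [|i].
  by rewrite mulr_ge0// sumr_ge0// => i _; rewrite sumr_ge0.
rewrite mxE (le_trans (ler_norm_sum _ _ _))//.
apply: (@le_trans _ _ (\sum_j `|A i j| * `|x|)).
  by apply: ler_sum => j _; rewrite normrM ler_wpM2l// coord_le_norm.
rewrite -mulr_suml ler_wpM2r// [leRHS](bigD1 i)//= lerDl sumr_ge0// => k _.
by rewrite sumr_ge0.
Qed.

Lemma test_fun_linear f A : A \in unitmx -> test_fun f -> test_fun (fun x => f (A *m x)).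
Proof.
move=> Au /test_funP[bf [M fM]]; apply/test_funP; split.
  have := bsmooth_affine A 0 bf.
  by congr bsmooth; apply/funext => x; rewrite addr0.
have [C C0 CP] := norm_mulmx (invmx A).
exists (C * M) => x Mx; apply: fM; rewrite ltNge; apply/negP => AM.
have := CP (A *m x); rewrite mulmxA mulVmx// mul1mx leNgt => /negP; apply.
by apply: le_lt_trans Mx; rewrite ler_wpM2l.
Qed.

Lemma lipschitz_eq (P Q : pt -> R) (L1 L2 : R) : 0 <= L1 -> 0 <= L2 ->
    (forall x y, `|P y - P x| <= L1 * `|y - x|) ->
    (forall x y, `|Q y - Q x| <= L2 * `|y - x|) ->
    (forall x s, 0 < s -> exists a b,
      [/\ `|a - x| <= 2 * s, `|b - x| <= 2 * s & P a = Q b]) ->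
  P = Q.
Proof.
move=> L10 L20 LP LQ PQ; apply/funext => x; apply/eqP.
rewrite -subr_eq0 -normr_le0; apply/ler_addgt0Pr => e e0; rewrite add0r.
pose M := 2 * (L1 + L2) + 1.
have M0 : 0 < M by rewrite ltr_wpDl// mulr_ge0// addr_ge0.
have s0 : 0 < e / M := divr_gt0 e0 M0.
have eM : e = e / M * M by rewrite divfK// gt_eqF.
have [a [b [aN bN ab]]] := PQ x (e / M) s0.
have h1 := le_trans (LP x a) (ler_wpM2l L10 aN).
have h2 := le_trans (LQ x b) (ler_wpM2l L20 bN).
have -> : P x - Q x = - (P a - P x) + (Q b - Q x) by rewrite ab; ring.
rewrite (le_trans (ler_normD _ _))// normrN (le_trans (lerD h1 h2))// [leRHS]eM.
move: (e / M) s0 => s s0; rewrite /M; lra.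
Qed.

Lemma second_difference f k l x (s : R) : bsmooth f -> exists xi, `|xi - x| <= 2 * `|s| /\
    f (x + s *: e_ l + s *: e_ k) - f (x + s *: e_ l) - (f (x + s *: e_ k) - f x) =
    s * (s * pd l (pd k f) xi).
Proof.
move=> bf; pose g y := f (y + s *: e_ l) - f y.
have bfs : bsmooth (fun y => f (y + s *: e_ l)) by exact: bsmooth_translate.
have bg : bsmooth g by exact: bsmoothB.
have [t /andP[t0 t1] gE] := line_MVT x k s (bsmooth_pdiff bg).
have [u /andP[u0 u1] uE] :=
  line_MVT (x + (t * s) *: e_ k) l s (bsmooth_pdiff (bsmooth_pd k bf)).
exists (x + (t * s) *: e_ k + (u * s) *: e_ l); split.
  rewrite (_ : _ - _ = (t * s) *: e_ k + (u * s) *: e_ l); last first.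
    by rewrite -[x + _ + _]addrA addrAC subrr add0r.
  have H w m : 0 <= w <= 1 -> `|(w * s) *: e_ m| <= `|s|.
    move=> /andP[w0 w1]; rewrite normrZ normrM (ger0_norm w0) -[leRHS]mulr1.
    by rewrite ler_pM ?norm_ebasis// ?mulr_ge0// -[leRHS]mul1r ler_wpM2r.
  rewrite (le_trans (ler_normD _ _))// mulr_natl mulr2n.
  by rewrite lerD// H// ?t0 ?u0.
rewrite -uE.
have gk : pd k g = fun y => pd k f (y + s *: e_ l) - pd k f y.
  by rewrite /g (pdB k bfs bf) (pd_translate (s *: e_ l) k bf).
rewrite gk in gE; rewrite -gE /g (addrAC x).
move: (f (x + s *: e_ k + s *: e_ l)) (f (x + s *: e_ k)) (f (x + s *: e_ l)) (f x).
by move=> c1 c2 c3 c4; ring.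
Qed.

(** The second difference is symmetric in [i] and [j] and equals [s ^ 2] times either mixed
    derivative at some point within [2 * s] of [x]. Both derivatives are Lipschitz, so they agree at
    [x] as [s] shrinks. *)
Lemma schwarz f i j : bsmooth f -> pd i (pd j f) = pd j (pd i f).
Proof.
move=> bf.
have [L1 L10 H1] := bsmooth_lipschitz (bsmooth_pd i (bsmooth_pd j bf)).
have [L2 L20 H2] := bsmooth_lipschitz (bsmooth_pd j (bsmooth_pd i bf)).
apply: (lipschitz_eq L10 L20 H1 H2) => x s s0.
have [a [aN aE]] := second_difference j i x s bf.
have [b [bN bE]] := second_difference i j x s bf.
exists a, b; rewrite (gtr0_norm s0) in aN bN; split; [exact: aN|exact: bN|].
have sN0 : s != 0 by rewrite gt_eqF.
move: (pd i (pd j f) a) (pd j (pd i f) b) aE bE => p q aE bE.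
apply: (mulfI sN0); apply: (mulfI sN0); rewrite -aE -bE.
rewrite (addrAC x).
move: (f (x + s *: e_ i + s *: e_ j)) (f (x + s *: e_ i)) (f (x + s *: e_ j)) (f x).
by move=> c1 c2 c3 c4; ring.
Qed.

Lemma dseq_pd s i f : bsmooth f -> dseq s (pd i f) = pd i (dseq s f).
Proof.
move=> bf; elim: s => //= j s IH.
transitivity (pd j (dseq s (pd i f))); first by [].
by rewrite IH schwarz//; exact: bsmooth_dseq.
Qed.

End SmoothClosure.

(** * Integration along a coordinate axis *)

Section CompactlySupported1d.
Variable R : realType.
Notation mu := (@lebesgue_measure R).
Implicit Types (g : R -> R) (M C : R) (D : set (measurableTypeR R)).

Lemma cc_integrable g M D : measurable D -> continuous g ->
  (forall t, M < `|t| -> g t = 0) -> mu.-integrable D (EFin \o g).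
Proof.
move=> mD cg gM; apply: (@integrableS _ _ _ _ setT) => //.
have : mu.-integrable `[- M, M] (EFin \o g).
  apply: continuous_compact_integrable; first exact: segment_compact.
  exact: continuous_subspaceT.
move=> iI; have := (@integrable_mkcond _ _ R mu _ (EFin \o g) (measurable_itv `[- M, M])).1 iI.
congr (mu.-integrable _ _); apply/funext => t; rewrite /patch.
case: ifPn => // tM; rewrite /= gM//.
by move: tM; rewrite notin_setE /= in_itv /= -ler_norml => /negP; rewrite -ltNge.
Qed.

(** [2 * M] is the length of the interval carrying [g]; a general [D] covers the line and the
    half-lines. *)
Lemma cc_Rintegral_bound g M C D : 0 <= M -> 0 <= C -> measurable D -> continuous g ->
  (forall t, M < `|t| -> g t = 0) -> (forall t, `|g t| <= C) ->
  `|Rintegral mu D g| <= C * (2 * M).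
Proof.
move=> M0 C0 mD cg gM gC.
pose I := `[- M, M]%classic : set (measurableTypeR R).
have mI : measurable I by exact: measurable_itv.
have mDI : measurable (D `&` I) by exact: measurableI.
have -> : Rintegral mu D g = Rintegral mu (D `&` I) g.
  rewrite Rintegral_mkcondr; apply: eq_Rintegral => t _; rewrite /patch.
  case: ifPn => //; rewrite notin_setE /I /= in_itv /= -ler_norml => /negP.
  by rewrite -ltNge => /gM.
have ig := cc_integrable mDI cg gM.
rewrite (le_trans (le_normr_Rintegral mDI ig))//.
have muI : mu I = (2 * M)%:E.
  rewrite lebesgue_measure_itv /= lte_fin; case: ltP => MM.
    by rewrite -EFinD; congr EFin; ring.
  by congr EFin; lra.
have fDI : (mu (D `&` I) <= (2 * M)%:E)%E.
  by rewrite -muI le_measure ?inE//; exact: subIsetr.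
have cfin : (mu (D `&` I) < +oo)%E by rewrite (le_lt_trans fDI) ?ltry.
apply: (@le_trans _ _ (Rintegral mu (D `&` I) (fun=> C))).
  apply: le_Rintegral => //.
    exact: integrable_norm.
  apply: (integrableS mI mDI); first exact: subIsetr.
  apply: continuous_compact_integrable; first exact: segment_compact.
  by apply: continuous_subspaceT; exact: cst_continuous.
rewrite Rintegral_cst// ler_wpM2l// -[leRHS]/(fine (2 * M)%:E).
by rewrite fine_le// ge0_fin_numE.
Qed.

End CompactlySupported1d.

Section LineIntegral.
Variables (R : realType) (d : nat).
Notation pt := 'cV[R]_d.
Notation e_ := (@ebasis R d).
Notation mu := (@lebesgue_measure R).
Implicit Types (f g : pt -> R) (x y : pt) (i j : 'I_d) (M t s : R) (D : set (measurableTypeR R)).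

Lemma set_coordE i t x : set_coord i t x = x + (t - x i 0) *: e_ i.
Proof.
apply/colP => j; rewrite !mxE eqxx andbT.
have [->|ji] := eqVneq j i; first by rewrite eqxx mulr1 addrC subrK.
by rewrite (_ : (j == i :> nat) = false) ?mulr0 ?addr0//; exact/negbTE.
Qed.

Lemma set_coord_at i t x : set_coord i t x i 0 = t.
Proof. by rewrite mxE eqxx. Qed.

Lemma set_coord_neq i j t x : j != i -> set_coord i t x j 0 = x j 0.
Proof. by move=> ji; rewrite mxE (_ : (j == i :> nat) = false)//; exact/negbTE. Qed.

Lemma set_coord_id i x : set_coord i (x i 0) x = x.
Proof. by rewrite set_coordE subrr scale0r addr0. Qed.

Lemma addZe_at i s x : (x + s *: e_ i) i 0 = x i 0 + s.
Proof. by rewrite !mxE !eqxx mulr1. Qed.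

Lemma addZe_neq i j s x : j != i -> (x + s *: e_ i) j 0 = x j 0.
Proof. by move=> ji; rewrite !mxE (negPf ji) mulr0 addr0. Qed.

Lemma set_coord_addi i t s x : set_coord i t (x + s *: e_ i) = set_coord i t x.
Proof.
apply/colP => j; rewrite mxE [RHS]mxE; have [->|ji] := eqVneq j i.
  by rewrite eqxx.
by rewrite addZe_neq.
Qed.

Lemma set_coord_addj i j t s x : i != j ->
  set_coord i t (x + s *: e_ j) = set_coord i t x + s *: e_ j.
Proof. by move=> ij; rewrite !set_coordE addZe_neq// addrAC. Qed.

Definition lsmooth i M f := [/\ 0 <= M, bsmooth f & supc i M f].

Lemma lsmoothW i M N f : M <= N -> lsmooth i M f -> lsmooth i N f.
Proof.
move=> MN [M0 bf sf]; split=> //; first exact: le_trans MN.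
by move=> x xN; apply: sf; exact: le_lt_trans xN.
Qed.

Lemma lsmooth_pd i j M f : lsmooth i M f -> lsmooth i M (pd j f).
Proof. by move=> [M0 bf sf]; split=> //; [exact: bsmooth_pd|exact: supc_pd]. Qed.

Lemma lsmoothD i M f g : lsmooth i M f -> lsmooth i M g -> lsmooth i M (fun x => f x + g x).
Proof.
move=> [M0 bf sf] [_ bg sg]; split=> //; first exact: bsmoothD.
by move=> x Mx; rewrite sf// sg// addr0.
Qed.

Lemma lsmoothMl i M f g : bsmooth f -> lsmooth i M g -> lsmooth i M (fun x => f x * g x).
Proof.
move=> bf [M0 bg sg]; split=> //; first exact: bsmoothM.
by move=> x Mx; rewrite sg// mulr0.
Qed.

Lemma lsmoothZ i M (a : R) g : lsmooth i M g -> lsmooth i M (fun x => a * g x).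
Proof. exact/lsmoothMl/bsmooth_cst. Qed.

Lemma lsmoothB i M f g : lsmooth i M f -> lsmooth i M g -> lsmooth i M (fun x => f x - g x).
Proof.
move=> [M0 bf sf] [_ bg sg]; split=> //; first exact: bsmoothB.
by move=> x Mx; rewrite sf// sg// subr0.
Qed.

Lemma lsmooth_translate i j M s f : i != j ->
  lsmooth i M f -> lsmooth i M (fun x => f (x + s *: e_ j)).
Proof.
move=> ij [M0 bf sf]; split=> //; first exact: bsmooth_translate.
by move=> x Mx; apply: sf; rewrite addZe_neq.
Qed.

Lemma test_fun_lsmooth f i : test_fun f -> exists M, lsmooth i M f.
Proof.
move=> /test_funP[bf [M fM]]; exists (Num.max 0 M); split=> //.
  by rewrite le_max lexx.
by move=> x; rewrite gt_max => /andP[_ Mx]; apply/fM/(lt_le_trans Mx)/coord_le_norm.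
Qed.

Lemma lsmooth_line_continuous i M f x : lsmooth i M f ->
  continuous (fun t => f (set_coord i t x)).
Proof.
move=> [_ bf _] t.
have -> : (fun t => f (set_coord i t x)) = (fun t => f (x - x i 0 *: e_ i + t *: e_ i)).
  by apply/funext => u; rewrite set_coordE scalerBl addrA addrAC.
apply: (@continuous_comp R pt R (fun t => _ + t *: e_ i) f t); first exact: line_continuous.
exact: bsmooth_continuous.
Qed.

Lemma lsmooth_line_supp i M f x t : lsmooth i M f -> M < `|t| -> f (set_coord i t x) = 0.
Proof. by move=> [_ _ sf] Mt; apply: sf; rewrite set_coord_at. Qed.

Lemma lsmooth_line_integrable i M f x D : measurable D -> lsmooth i M f ->
  mu.-integrable D (EFin \o (fun t => f (set_coord i t x))).
Proof.
move=> mD lf; apply: (@cc_integrable _ _ M) => //; first exact: lsmooth_line_continuous lf.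
by move=> t; exact: lsmooth_line_supp.
Qed.

Definition lint i D f x : R := Rintegral mu D (fun t => f (set_coord i t x)).

Lemma lintD i M D f g x : measurable D -> lsmooth i M f -> lsmooth i M g ->
  lint i D (fun x => f x + g x) x = lint i D f x + lint i D g x.
Proof.
move=> mD lf lg.
exact: RintegralD mD (lsmooth_line_integrable x mD lf) (lsmooth_line_integrable x mD lg).
Qed.

Lemma lintB i M D f g x : measurable D -> lsmooth i M f -> lsmooth i M g ->
  lint i D (fun x => f x - g x) x = lint i D f x - lint i D g x.
Proof.
move=> mD lf lg.
exact: RintegralB mD (lsmooth_line_integrable x mD lf) (lsmooth_line_integrable x mD lg).
Qed.

Lemma lintZ i M D (a : R) f x : measurable D -> lsmooth i M f ->
  lint i D (fun x => a * f x) x = a * lint i D f x.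
Proof.
by move=> mD lf; exact: RintegralZl mD (lsmooth_line_integrable x mD lf).
Qed.

Lemma lint_bound i M D f C x : measurable D -> lsmooth i M f ->
  (forall x, `|f x| <= C) -> `|lint i D f x| <= C * (2 * M).
Proof.
move=> mD lf fC; apply: cc_Rintegral_bound => //.
- by case: lf.
- exact: le_trans (fC 0).
- exact: lsmooth_line_continuous lf.
- by move=> t; exact: lsmooth_line_supp.
Qed.

(** Differentiation under the integral sign in quantitative form: the Taylor remainder is [O(h ^ 2)]
    uniformly and lives on a slab of width [2 * M]. *)
Lemma lint_quadratic i j M f : i != j -> lsmooth i M f ->
  exists C, forall (D : set (measurableTypeR R)) x h, measurable D ->
  `|lint i D f (x + h *: e_ j) - lint i D f x - h * lint i D (pd j f) x| <= C * h ^+ 2.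
Proof.
move=> ij lf; have [_ bf _] := lf.
have [C C0 fC] := bsmooth_taylor j bf.
exists (C * (2 * M)) => D x h mD.
have lt := lsmooth_translate h ij lf.
have lp := lsmoothZ h (lsmooth_pd j lf).
have -> : lint i D f (x + h *: e_ j) = lint i D (fun y => f (y + h *: e_ j)) x.
  by rewrite /lint; under eq_fun do rewrite set_coord_addj//.
rewrite -(lintB _ mD lt lf) -(lintZ _ _ mD (lsmooth_pd j lf)).
rewrite -(lintB _ mD (lsmoothB lt lf) lp) mulrAC.
apply: lint_bound => //; first exact: lsmoothB (lsmoothB lt lf) lp.
Qed.

Definition itot i f := lint i setT f.
Definition iprim i f : pt -> R := fun x => lint i `]-oo, x i 0] f x.

Lemma itot_addi i f x s : itot i f (x + s *: e_ i) = itot i f x.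
Proof. by rewrite /itot /lint; under eq_fun do rewrite set_coord_addi. Qed.

Lemma itot_set i f x s : itot i f (set_coord i s x) = itot i f x.
Proof. by rewrite set_coordE itot_addi. Qed.

Lemma is_derive_itot i j M f x : lsmooth i M f -> is_derive x (e_ j) (itot i f)
  (if i == j then 0 else itot i (pd j f) x).
Proof.
move=> lf; case: eqVneq => [<-|ij].
  apply: (@is_derive_quadratic _ _ _ _ _ _ 0) => h.
  by rewrite itot_addi subrr mulr0 subr0 normr0 mul0r.
have [C CP] := lint_quadratic ij lf.
by apply: (@is_derive_quadratic _ _ _ _ _ _ C) => h; exact: CP.
Qed.

Lemma lsmooth0 i M : 0 <= M -> lsmooth i M (fun=> 0).
Proof. by move=> M0; split=> //; exact: bsmooth_cst. Qed.

Lemma lint0 i D x : lint i D (fun=> 0) x = 0.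
Proof. by rewrite /lint /Rintegral integral0. Qed.

Lemma bsmooth_itot i M f : lsmooth i M f -> bsmooth (itot i f).
Proof.
move=> lf; apply: (@bsmooth_coind _ _ (fun h => exists2 g, lsmooth i M g & h = itot i g)).
  move=> _ [g lg ->]; split.
    have [_ bg _] := lg; have [C gC] := bsmooth_bounded bg.
    by exists (C * (2 * M)) => x; exact: lint_bound.
  move=> j; have [ij|ij] := eqVneq i j.
    exists (itot i (fun=> 0)).
      by eexists; last reflexivity; apply: lsmooth0; case: lg.
    by move=> x; have := is_derive_itot j x lg; rewrite ij eqxx /itot lint0.
  exists (itot i (pd j g)); first by exists (pd j g) => //; exact: lsmooth_pd.
  by move=> x; have := is_derive_itot j x lg; rewrite (negPf ij).
by exists f.
Qed.

Lemma is_derive_iprim i j M f x : lsmooth i M f -> is_derive x (e_ j) (iprim i f)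
  (if i == j then f x else iprim i (pd j f) x).
Proof.
move=> lf; case: eqVneq => [<-|ij].
  pose g t := f (set_coord i t x).
  have cg : continuous g by exact: lsmooth_line_continuous lf.
  have xu : x i 0 < x i 0 + 1 by rewrite ltrDl.
  have ig : mu.-integrable [set` Interval -oo%O (BRight (x i 0 + 1))] (EFin \o g).
    exact: (lsmooth_line_integrable x _ lf).
  have [||dF FE] := continuous_FTC1 xu ig.
  - by rewrite ltNye.
  - exact: cg.
  have {}dF := @derivableP _ _ _ _ _ _ dF; rewrite -derive1E FE in dF.
  have -> : f x = g (x i 0) by rewrite /g set_coord_id.
  pose F t := Rintegral mu `]-oo, t] g; move/is_deriveP: dF => dF; apply/is_deriveP.
  suff -> : (fun h => h^-1 * (iprim i f (x + h *: e_ i) - iprim i f x)) =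
      (fun h : R => h^-1 * (F (x i 0 + h *: 1) - F (x i 0))) by [].
  apply/funext => h; congr (_ * (_ - _)).
  rewrite /iprim /lint addZe_at -[h *: 1]/(h * 1) mulr1; congr Rintegral.
  by apply/funext => t; rewrite set_coord_addi.
have [C CP] := lint_quadratic ij lf.
apply: (@is_derive_quadratic _ _ _ _ _ _ C) => h.
by rewrite /iprim addZe_neq//; exact: CP.
Qed.

(** Differentiating along [e_i] leaves the family of primitives and returns the integrand, so the
    coinductive class also contains [bsmooth]. *)
Lemma bsmooth_iprim i M f : lsmooth i M f -> bsmooth (iprim i f).
Proof.
move=> lf; apply: (@bsmooth_coind _ _
    (fun h => bsmooth h \/ exists2 g, lsmooth i M g & h = iprim i g)).
  move=> h [bh|[g lg ->]].
    split; first exact: bsmooth_bounded.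
    move=> j; exists (pd j h); first by left; exact: bsmooth_pd.
    by move=> x; exact: bsmooth_derive.
  have [_ bg _] := lg; split.
    by have [C gC] := bsmooth_bounded bg; exists (C * (2 * M)) => x; exact: lint_bound.
  move=> j; have [ij|ij] := eqVneq i j.
    by exists g; [left|move=> x; have := is_derive_iprim j x lg; rewrite ij eqxx].
  exists (iprim i (pd j g)); first by right; exists (pd j g) => //; exact: lsmooth_pd.
  by move=> x; have := is_derive_iprim j x lg; rewrite (negPf ij).
by right; exists f.
Qed.

Lemma pd_iprim i M f : lsmooth i M f -> pd i (iprim i f) = f.
Proof.
by move=> lf; apply: pdE => x; have := is_derive_iprim i x lf; rewrite eqxx.
Qed.

Lemma iprim_left i M f x : lsmooth i M f -> x i 0 < - M -> iprim i f x = 0.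
Proof.
move=> lf xM; rewrite /iprim /lint (_ : Rintegral _ _ _ = Rintegral mu `]-oo, x i 0] (fun=> 0)).
  by rewrite /Rintegral integral0.
apply: eq_Rintegral => t; rewrite inE /= in_itv /= => tx.
by apply: (lsmooth_line_supp _ lf); have := ler_norm (- t); rewrite normrN; lra.
Qed.

Lemma iprim_right i M f x : lsmooth i M f -> M < x i 0 -> iprim i f x = itot i f x.
Proof.
move=> lf xM; rewrite /iprim /itot /lint Rintegral_mkcond.
apply: eq_Rintegral => t _; rewrite /patch; case: ifPn => //.
rewrite notin_setE /= in_itv /= => /negP; rewrite -ltNge => xt.
by rewrite (lsmooth_line_supp _ lf)//; have := ler_norm t; lra.
Qed.

(** The primitive of [pd i f] and [f] differ by a constant on each line; the points [a] and [b], on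
    either side of the support, determine it twice. *)
Lemma itot_pd i M f x : lsmooth i M f -> itot i (pd i f) x = 0.
Proof.
move=> lf; have [M0 bf sf] := lf; have lp := lsmooth_pd i lf.
pose g y := iprim i (pd i f) y - f y.
have bK := bsmooth_iprim lp.
have bg : bsmooth g by exact: bsmoothB.
have pg : pd i g = fun=> 0.
  by rewrite /g pdB// (pd_iprim lp); apply/funext => y; rewrite subrr.
pose a := set_coord i (- (M + 1)) x.
pose b := a + (2 * (M + 1)) *: e_ i.
have [t _] := line_MVT a i (2 * (M + 1)) (bsmooth_pdiff bg).
rewrite pg mulr0 => /eqP; rewrite -/b subr_eq0 => /eqP.
have ai : a i 0 = - (M + 1) by exact: set_coord_at.
have bi : b i 0 = M + 1 by rewrite /b addZe_at ai; ring.
rewrite /g (iprim_left (x := a) lp); last by rewrite ai; lra.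
rewrite (iprim_right (x := b) lp); last by rewrite bi; lra.
have -> : f a = 0 by apply: sf; rewrite ai normrN ger0_norm; lra.
have -> : f b = 0 by apply: sf; rewrite bi ger0_norm; lra.
by rewrite /b /a itot_addi itot_set !subr0.
Qed.

Lemma itot_supp i M f : supp_in_ball M f -> forall x j, i != j -> M < `|x j 0| -> itot i f x = 0.
Proof.
move=> fM x j ij xM; rewrite /itot /lint (_ : (fun t => _) = fun=> 0).
  by rewrite /Rintegral integral0.
apply/funext => t; apply/fM/(lt_le_trans xM).
by rewrite -(@set_coord_neq i j t x) ?coord_le_norm// eq_sym.
Qed.

(** To the right of the support the primitive equals the integral along the whole line, so the
    vanishing of the latter keeps its support bounded. *)
Lemma test_fun_iprim i f : test_fun f -> itot i f = (fun=> 0) -> test_fun (iprim i f).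
Proof.
move=> tf f0; have [M lf] := test_fun_lsmooth i tf.
have /test_funP[bf [N fN]] := tf.
apply/test_funP; split; first exact: bsmooth_iprim lf.
pose K := Num.max M N; have M0 : 0 <= M by case: lf.
have K0 : 0 <= K by rewrite le_max M0.
exists K => x Kx.
have [j Kj] : exists j, K < `|x j 0|.
  apply: contrapT => nK; move: Kx; rewrite ltNge => /negP; apply.
  by apply: norm_le_coord => // j; rewrite leNgt; apply/negP => Kj; apply: nK; exists j.
move: Kj; rewrite gt_max => /andP[Mj Nj].
have [ij|ij] := eqVneq i j; last first.
  rewrite /iprim /lint (_ : (fun t => _) = fun=> 0); first by rewrite /Rintegral integral0.
  apply/funext => t; apply/fN/(lt_le_trans Nj).
  by rewrite -(@set_coord_neq i j t x) ?coord_le_norm// eq_sym.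
rewrite -ij in Mj; case: (leP 0 (x i 0)) => x0.
  by rewrite (iprim_right lf) ?f0//; move: Mj; rewrite ger0_norm.
by rewrite (iprim_left lf)//; move: Mj; rewrite ltr0_norm//; lra.
Qed.

End LineIntegral.

(** * Distributions annihilated by iterated differences *)

(** The increments [1 / (k + 1)] keep the sample points rational for integral [a], and interpolation
    is available there. The limit is read off by dividing [p(X + a) - p(a)] by [X]. *)
Lemma poly_difference_quotient (R : realType) (p : {poly R}) (a : R) :
  (fun k : nat => k.+1%:R * (p.[a + k.+1%:R^-1] - p.[a])) @ \oo --> p^`().[a].
Proof.
pose r := p \Po ('X + a%:P) - p.[a]%:P.
have /factor_theorem[q qE] : root r 0.
  by rewrite rootE /r !hornerE horner_comp !hornerE subrr.
have rE h : p.[a + h] - p.[a] = q.[h] * h.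
  have := congr1 (fun P => P.[h]) qE.
  by rewrite /r !hornerE horner_comp !hornerE subr0 [h + a]addrC.
have -> : p^`().[a] = q.[0].
  have := congr1 (fun P => P^`().[0]) qE.
  rewrite /r derivB derivC deriv_comp derivD derivX derivC subr0 addr0 mulr1 horner_comp.
  by rewrite !hornerE derivM derivB derivX derivC subr0 !hornerE subr0 mulr1.
have -> : (fun k : nat => k.+1%:R * (p.[a + k.+1%:R^-1] - p.[a])) = horner q \o @harmonic R.
  by apply/funext => k /=; rewrite rE mulrC mulfVK.
apply: (cvg_comp (@harmonic R) (horner q)); first exact: cvg_harmonic.
exact: continuous_horner.
Qed.

Section Distribution.
Variables (R : realType) (d : nat).
Notation pt := 'cV[R]_d.
Notation e_ := (@ebasis R d).
Notation mu := (@lebesgue_measure R).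
Variables (T : distrib_fun R d).
Hypothesis TT : is_distribution T.
Implicit Types (f g : pt -> R) (x y : pt) (i j : 'I_d).

Lemma distr_lin f g (a : R) : test_fun f -> test_fun g ->
  T (fun x => f x + a * g x) = T f + a * T g.
Proof. by case: TT => h _; exact: h. Qed.

Lemma distrD f g : test_fun f -> test_fun g -> T (fun x => f x + g x) = T f + T g.
Proof.
move=> tf tg; rewrite -[T g]mul1r -distr_lin//.
by congr T; apply/funext => x; rewrite mul1r.
Qed.

Lemma distr0 : T (fun=> 0) = 0.
Proof.
have := distrD (test_fun0 R d) (test_fun0 R d).
rewrite (_ : (fun x => 0 + 0) = fun=> 0); last by apply/funext => x; rewrite addr0.
by move/eqP; rewrite -subr_eq subrr => /eqP.
Qed.

Lemma distrZ f (a : R) : test_fun f -> T (fun x => a * f x) = a * T f.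
Proof.
move=> tf; rewrite -[RHS]add0r -distr0 -distr_lin//; last exact: test_fun0.
by congr T; apply/funext => x; rewrite add0r.
Qed.

Lemma test_fun_sum (I : Type) (r : seq I) (F : I -> pt -> R) :
  (forall l, test_fun (F l)) -> test_fun (fun x => \sum_(l <- r) F l x).
Proof.
move=> tF; elim: r => [|l r IH].
  by under eq_fun do rewrite big_nil; exact: test_fun0.
by under eq_fun do rewrite big_cons; exact: test_funD.
Qed.

Lemma dseqD s f g : bsmooth f -> bsmooth g ->
  dseq s (fun x => f x + g x) = fun x => dseq s f x + dseq s g x.
Proof.
move=> bf bg; elim: s => //= i s ->.
exact: (pdD i (bsmooth_dseq s bf) (bsmooth_dseq s bg)).
Qed.

Lemma dseqZ s f (a : R) : bsmooth f -> dseq s (fun x => a * f x) = fun x => a * dseq s f x.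
Proof.
by move=> bf; elim: s => //= i s ->; exact: (pdZ a i (bsmooth_dseq s bf)).
Qed.

Lemma dseq_translate s f b : bsmooth f ->
  dseq s (fun x => f (x + b)) = fun x => dseq s f (x + b).
Proof.
by move=> bf; elim: s => //= i s ->; exact: (pd_translate b i (bsmooth_dseq s bf)).
Qed.

(** The error [q k] tends to [0] in the space of test functions: Taylor's estimate bounds each of
    its derivatives by [C / (k + 1)], and its support stays in radius [M + 1] because the shifts are
    at most [1]. *)
Lemma distr_pd i f : test_fun f ->
  (fun k : nat => k.+1%:R * (T (fun x => f (x - k.+1%:R^-1 *: e_ i)) - T f)) @ \oo
    --> - T (pd i f).
Proof.
move=> tf; have bf := test_fun_bsmooth tf.
have tpf := test_fun_pd i tf.
pose ft k x := f (x + (- k.+1%:R^-1) *: e_ i).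
have tft k : test_fun (ft k) by exact: test_fun_translate.
pose q k x := k.+1%:R * (ft k x + -1 * f x) + pd i f x.
have tdiff k : test_fun (fun x => ft k x + -1 * f x).
  by apply: test_funD => //; exact: test_funZ.
have tq k : test_fun (q k) by apply: test_funD => //; exact: test_funZ.
have qE k : k.+1%:R * (T (fun x => f (x - k.+1%:R^-1 *: e_ i)) - T f) =
    T (q k) - T (pd i f).
  rewrite /q distrD//; last exact: test_funZ.
  rewrite addrK distrZ// distr_lin// mulN1r; congr (_ * (T _ - _)).
  by apply/funext => x; rewrite /ft scaleNr.
under eq_fun do rewrite qE.
suff q0 : (fun k => T (q k)) @ \oo --> (0 : R).
  have := @cvgB R _ nat \oo _ (fun k => T (q k)) (cst (T (pd i f))) _ _ q0 (cvg_cst _).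
  by rewrite sub0r => H; exact: H.
have [_ Tc] := TT; have /test_funP[_ [M fM]] := tf.
apply: (Tc q (M + 1)) => // [k x xM|s e e0].
  rewrite /q /ft !fM ?(supp_in_ball_pd _ fM) ?mulr0 ?addr0 ?mulr0//; try lra.
  have := ler_normD (x + - k.+1%:R^-1 *: e_ i) (k.+1%:R^-1 *: e_ i).
  rewrite scaleNr subrK.
  have : `|k.+1%:R^-1 *: e_ i| <= 1.
    rewrite normrZ -[leRHS]mulr1 ler_pM ?norm_ebasis// normfV ger0_norm//.
    by rewrite invf_le1 ?ler1n ?ltr0n.
  lra.
have [C C0 fC] := bsmooth_taylor i (bsmooth_dseq s bf).
exists (Num.bound (C / e)) => k x kN.
have k0 : 0 < k.+1%:R :> R by rewrite ltr0n.
have dE : dseq s (q k) x = k.+1%:R * (dseq s f (x + (- k.+1%:R^-1) *: e_ i)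
    - dseq s f x - (- k.+1%:R^-1) * pd i (dseq s f) x).
  rewrite /q dseqD; last 2 first.
  - exact/bsmoothZ/test_fun_bsmooth/tdiff.
  - exact: test_fun_bsmooth.
  rewrite dseqZ; last exact/test_fun_bsmooth/tdiff.
  rewrite dseqD; last 2 first.
  - exact/test_fun_bsmooth/tft.
  - exact: bsmoothZ.
  rewrite dseqZ// /ft dseq_translate// dseq_pd//.
  move: (dseq s f (_ + _)) (dseq s f x) (pd i _ x) => u v w.
  by move: (k.+1%:R) k0 => K K0; field; rewrite gt_eqF.
rewrite dE normrM (gtr0_norm k0).
apply: (@le_lt_trans _ _ (C / k.+1%:R)).
  apply: (le_trans (ler_wpM2l (ltW k0) (fC _ _))).
  move: (_.+1%:R) k0 => K K0.
  by rewrite le_eqVlt; apply/orP; left; apply/eqP; field; rewrite gt_eqF.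
rewrite ltr_pdivrMr// -ltr_pdivrMl// mulrC.
apply: (lt_le_trans (archi_boundP _)).
  by rewrite mulr_ge0// invr_ge0 ltW.
by rewrite ler_nat ltnW.
Qed.

Section Annihilated.
Variable m : nat.
Hypothesis Tm : forall h f, test_fun f ->
  iter m (fun F => fun g => dtau h F g - F g) T f = 0.

Definition along i f (s : R) : R := T (fun x => f (x - s *: e_ i)).

Lemma iter_dtau_along i f (t s : R) k :
  iter k (fdiff t) (along i f) s =
  iter k (fun F => fun g => dtau (t *: e_ i) F g - F g) T (fun x => f (x - s *: e_ i)).
Proof.
elim: k s => //= k IH s; rewrite /fdiff !IH /dtau; congr (_ - _).
congr (iter _ _ _ _); apply/funext => x; congr f.
by rewrite scalerDl opprD addrA addrAC.
Qed.

Lemma along_poly i f (z : int) (N : nat) : test_fun f ->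
  along i f (z%:~R / N.+1%:R) = (newton_interp m (along i f)).[z%:~R / N.+1%:R].
Proof.
move=> tf; apply: newton_interp_rat => t s.
by rewrite iter_dtau_along Tm//; exact: test_fun_translate.
Qed.

Lemma along_nat i f (n : nat) : test_fun f ->
  along i f n%:R = (newton_interp m (along i f)).[n%:R].
Proof. by move=> tf; have := along_poly i n 0 tf; rewrite divr1. Qed.

(** At a natural number, [distr_pd] yields minus a limit of difference quotients of [along i f].
    Their sample points are rational, so the limit is the derivative of the interpolating
    polynomial. *)
Lemma newton_along_pd i f : test_fun f ->
  newton_interp m (along i (pd i f)) = - (newton_interp m (along i f))^`().
Proof.
move=> tf; apply: poly_nat_inj => n; rewrite -along_nat; last exact: test_fun_pd.
rewrite hornerN; set p := newton_interp m (along i f).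
pose fn x := f (x - n%:R *: e_ i).
have tfn : test_fun fn by exact: test_fun_translate.
have := distr_pd (i := i) tfn.
have -> : pd i fn = fun x => pd i f (x - n%:R *: e_ i).
  by rewrite /fn pd_translate//; exact: test_fun_bsmooth.
have -> : (fun k : nat => k.+1%:R * (T (fun x => fn (x - k.+1%:R^-1 *: e_ i)) - T fn)) =
    (fun k : nat => k.+1%:R * (p.[n%:R + k.+1%:R^-1] - p.[n%:R])).
  apply/funext => k; congr (_ * (_ - _)); last by rewrite -along_nat.
  have -> : n%:R + k.+1%:R^-1 = (n * k.+1 + 1)%N%:Z%:~R / k.+1%:R :> R.
    by rewrite -[_%:~R]/((n * k.+1 + 1)%:R) natrD natrM mulrDl mulfK ?div1r// pnatr_eq0.
  rewrite -along_poly// /along; congr T; apply/funext => x; rewrite /fn; congr f.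
  have -> : (n * k.+1 + 1)%N%:Z%:~R / k.+1%:R = n%:R + k.+1%:R^-1 :> R.
    by rewrite -[_%:~R]/((n * k.+1 + 1)%:R) natrD natrM mulrDl mulfK ?div1r// pnatr_eq0.
  by rewrite scalerDl opprD addrA addrAC.
move=> c1; have c2 := @poly_difference_quotient R p n%:R.
have E : - T (fun x => pd i f (x - n%:R *: e_ i)) = p^`().[n%:R].
  by rewrite -(cvg_lim _ c1)// -(cvg_lim _ c2).
by rewrite /along -E opprK.
Qed.

Lemma distr_pd_annihilates i f : test_fun f -> T (iter m (pd i) f) = 0.
Proof.
move=> tf.
have H k : test_fun (iter k (pd i) f) /\ newton_interp m (along i (iter k (pd i) f)) =
    (-1) ^+ k *: (newton_interp m (along i f))^`(k).
  elim: k => [|k [tk IH]]; first by rewrite expr0 scale1r derivn0.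
  rewrite iterS derivnS.
  split; first exact: test_fun_pd.
  by rewrite newton_along_pd// IH derivZ exprS -scalerA scaleN1r.
have [tm pm] := H m.
have := along_nat i 0 tm; rewrite pm derivn_poly0 ?size_newton_interp//.
rewrite scaler0 horner0 => <-; congr T; apply/funext => x.
by rewrite scale0r subr0.
Qed.

End Annihilated.
End Distribution.

(** * Reduction of a distribution to moments *)

Section Moments.
Variables (R : realType) (d : nat).
Notation pt := 'cV[R]_d.
Notation e_ := (@ebasis R d).
Notation mu := (@lebesgue_measure R).
Implicit Types (f g : pt -> R) (x y : pt) (i j : 'I_d) (M : R) (p : {poly R}).

Lemma is_derive_horner_coord p i x :
  is_derive x (e_ i) (fun y : pt => p.[y i 0]) p^`().[x i 0].
Proof.
apply/is_deriveP.
have -> : (fun h => h^-1 * (p.[(x + h *: e_ i) i 0] - p.[x i 0])) =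
    (fun h : R => h^-1 * (p.[x i 0 + h *: 1] - p.[x i 0])).
  by apply/funext => h; rewrite addZe_at -[h *: 1]/(h * 1) mulr1.
by apply/is_deriveP; have := is_derive_poly p (x i 0).
Qed.

(** The unbounded factor [x_i] is harmless on a slab. Derivatives of [x_i f] acquire terms without
    this factor, whence the family [x_i f + g]. *)
Lemma lsmoothX i M f : lsmooth i M f -> lsmooth i M (fun x => x i 0 * f x).
Proof.
move=> [M0 bf sf]; split=> //; last by move=> x Mx; rewrite sf// mulr0.
apply: (@bsmooth_coind _ _ (fun h => exists f g,
  [/\ lsmooth i M f, lsmooth i M g & h = fun x => x i 0 * f x + g x])); last first.
  exists f, (fun=> 0); split=> //; first exact: lsmooth0.
  by apply/funext => x; rewrite addr0.
move=> _ {sf bf f} [f [g [lf lg ->]]].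
have [[_ bf sf] [_ bg sg]] := (lf, lg); split.
  have [[C fC] [D gD]] := (bsmooth_bounded bf, bsmooth_bounded bg).
  exists (M * C + D) => x; rewrite (le_trans (ler_normD _ _))// lerD// normrM.
  have [xM|xM] := leP `|x i 0| M; first by rewrite ler_pM.
  by rewrite sf// normr0 mulr0 mulr_ge0// (le_trans _ (fC 0)).
move=> j; exists (fun x => x i 0 * pd j f x + ((i == j)%:R * f x + pd j g x)).
  exists (pd j f), (fun x => (i == j)%:R * f x + pd j g x); split=> //.
    exact: lsmooth_pd.
  by apply: lsmoothD; [exact: lsmoothZ|exact: lsmooth_pd].
move=> x; have dx : is_derive x (e_ j) (fun y : pt => y i 0) (i == j)%:R.
  apply: (@is_derive_quadratic _ _ _ _ _ _ 0) => h.
  rewrite !mxE eqxx andbT mul0r normr_le0; apply/eqP; ring.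
have dM := is_deriveM dx (bsmooth_derive j x bf).
have := is_deriveD dM (bsmooth_derive j x bg).
congr is_derive; rewrite -[_ *: pd j f x]/(_ * _) -[f x *: _]/(_ * _).
by ring.
Qed.

Lemma lsmooth_poly i M p f : lsmooth i M f -> lsmooth i M (fun x => p.[x i 0] * f x).
Proof.
move=> lf; elim/poly_ind: p => [|p c IH].
  have -> : (fun x => (0 : {poly R}).[x i 0] * f x) = fun=> 0.
    by apply/funext => x; rewrite horner0 mul0r.
  by apply: lsmooth0; case: lf.
have -> : (fun x => (p * 'X + c%:P).[x i 0] * f x) =
    (fun x => x i 0 * (p.[x i 0] * f x) + c * f x).
  by apply/funext => x; rewrite hornerMXaddC; ring.
by apply: lsmoothD; [exact: lsmoothX|exact: lsmoothZ].
Qed.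

Lemma test_fun_poly i p f : test_fun f -> test_fun (fun x => p.[x i 0] * f x).
Proof.
move=> tf; have [M lf] := test_fun_lsmooth i tf.
have [_ bpf _] := lsmooth_poly p lf; have /test_funP[_ [N fN]] := tf.
by apply/test_funP; split=> //; exists N => x /fN ->; rewrite mulr0.
Qed.

Definition moment i p f : pt -> R := itot i (fun y : pt => p.[y i 0] * f y).

Lemma poly_antiderivative p : exists P, P^`() = p.
Proof.
exists (\sum_(k < size p) (p`_k / k.+1%:R) *: 'X^(k.+1)).
rewrite raddf_sum -[RHS]coefK poly_def; apply: eq_bigr => k _.
by rewrite /= derivZ derivXn -['X^_ *+ _]scaler_nat scalerA divfK// pnatr_eq0.
Qed.

(** Integration by parts: the derivative of [p * iprim i f] has integral zero, the primitive being a
    test function. *)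
Lemma moment_iprim i p f x : test_fun f -> itot i f = (fun=> 0) ->
  moment i p^`() (iprim i f) x = - moment i p f x.
Proof.
move=> tf f0; have tK := test_fun_iprim tf f0.
have [M1 lf] := test_fun_lsmooth i tf.
have [M2 lK] := test_fun_lsmooth i tK.
pose M := Num.max M1 M2.
have {}lf : lsmooth i M f by apply: lsmoothW lf; rewrite le_max lexx.
have {}lK : lsmooth i M (iprim i f) by apply: lsmoothW lK; rewrite le_max lexx orbT.
have lh := lsmooth_poly p lK.
have := itot_pd x lh.
have -> : pd i (fun y => p.[y i 0] * iprim i f y) =
    fun y => p^`().[y i 0] * iprim i f y + p.[y i 0] * f y.
  apply: pdE => y; have [_ bK _] := lK.
  have := is_deriveM (is_derive_horner_coord p i y) (bsmooth_derive i y bK).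
  rewrite (pd_iprim lf); congr is_derive.
  by rewrite -[_ *: f y]/(_ * _) -[iprim i f y *: _]/(_ * _); ring.
rewrite /itot (lintD _ _ (lsmooth_poly _ lK) (lsmooth_poly _ lf))//.
by move/eqP; rewrite addr_eq0 => /eqP.
Qed.

Definition dep_only i f := forall x y, x i 0 = y i 0 -> f x = f y.

Lemma dep_only_pd i f : dep_only i f -> dep_only i (pd i f).
Proof.
move=> df x y xy; rewrite /pd /derive.
have -> // : (fun h : R => h^-1 *: ((f \o shift x) (h *: e_ i) - f x)) =
          (fun h : R => h^-1 *: ((f \o shift y) (h *: e_ i) - f y)).
apply/funext => h /=; rewrite (df x y xy); congr (_ *: (_ - _)).
by apply: df; rewrite !mxE xy.
Qed.

Lemma itot_dep_only i f x y : dep_only i f -> itot i f x = itot i f y.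
Proof.
move=> df; rewrite /itot /lint; congr Rintegral; apply/funext => t.
by apply: df; rewrite !set_coord_at.
Qed.

Lemma itotMr i M f g x : lsmooth i M f -> (forall t x, g (set_coord i t x) = g x) ->
  itot i (fun y : pt => f y * g y) x = itot i f x * g x.
Proof.
move=> lf gi; rewrite /itot /lint; under eq_fun do rewrite gi.
by apply: RintegralZr => //; exact: lsmooth_line_integrable lf.
Qed.

Lemma test_fun_Mitot i M a f : lsmooth i M a -> test_fun f ->
  test_fun (fun x => a x * itot i f x).
Proof.
move=> la tf; have [N lf] := test_fun_lsmooth i tf.
have [M0 ba sa] := la; have /test_funP[_ [K fK]] := tf.
apply/test_funP; split; first exact/bsmoothM/(bsmooth_itot lf).
exists (Num.max M K) => x Lx.
have [j] : exists j, Num.max M K < `|x j 0|.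
  apply: contrapT => nK; move: Lx; rewrite ltNge => /negP; apply.
  apply: norm_le_coord => [|j]; first by rewrite le_max M0.
  by rewrite leNgt; apply/negP => Kj; apply: nK; exists j.
rewrite gt_max => /andP[Mj Kj]; have [ij|ij] := eqVneq i j.
  by rewrite sa ?mul0r// ij.
by rewrite (itot_supp fK ij Kj) mulr0.
Qed.

(* No explicit bump function is needed: any nonzero test function, squared and restricted to a
   line, can be normalised. *)
Lemma exists_bump i (f0 : pt -> R) : test_fun f0 -> (exists x, f0 x != 0) ->
  exists M eta, [/\ lsmooth i M eta, dep_only i eta & itot i eta = fun=> 1].
Proof.
move=> tf [x0 fx0]; have bf := test_fun_bsmooth tf.
have [M [M0 _ sf]] := test_fun_lsmooth i tf.
pose f1 (x : pt) := f0 (set_coord i (x i 0) x0).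
(* Written as [f0] after the affine projection onto the line through [x0] along [e_i], [f1] falls
   under [bsmooth_affine]. *)
have f1E : f1 = fun x => f0 (delta_mx i i *m x + (x0 - x0 i 0 *: e_ i)).
  apply/funext => x; congr f0; rewrite set_coordE scalerBl addrCA; congr (_ + _).
  apply/colP => j; rewrite !mxE eqxx andbT (bigD1 i)//= mxE eqxx andbT.
  by rewrite big1 ?addr0 1?mulrC// => k ki; rewrite mxE (negPf ki) andbF mul0r.
have bf1 : bsmooth f1 by rewrite f1E; exact: bsmooth_affine.
pose g x := f1 x * f1 x.
have lg : lsmooth i M g.
  split=> //; first exact: bsmoothM.
  by move=> x Mx; rewrite /g /f1 sf ?mul0r// set_coord_at.
have dg : dep_only i g by move=> x y xy; rewrite /g /f1 xy.
have g0 x : 0 <= g x by rewrite /g -expr2 sqr_ge0.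
pose c := itot i g x0.
have cN0 : c != 0.
  apply/negP => /eqP c0.
  (* The primitive of [g >= 0] lies between [0] and the total integral; if the latter were [0], so
     would be the primitive and its derivative [g]. *)
  have K0 x : iprim i g x = 0.
    apply/eqP; rewrite eq_le; apply/andP; split; last exact: Rintegral_ge0.
    rewrite -c0 /c (itot_dep_only x0 x dg) /iprim /itot /lint Rintegral_mkcond.
    apply: le_Rintegral => //.
    - have := lsmooth_line_integrable x (measurable_itv `]-oo, x i 0]) lg.
      move/(@integrable_mkcond _ _ R mu _ (EFin \o (fun t => g (set_coord i t x)))
        (measurable_itv `]-oo, x i 0])).1.
      congr (mu.-integrable _ _); apply/funext => t.
      by rewrite /patch /=; case: ifP.
    - exact: lsmooth_line_integrable lg.
    - by move=> t _; rewrite /patch; case: ifP.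
  have := pd_iprim lg; rewrite (_ : iprim i g = fun=> 0); last exact/funext.
  rewrite pd_cst => /(congr1 (fun h => h x0)) /esym/eqP.
  by rewrite /g /f1 set_coord_id mulf_eq0 orbb (negPf fx0).
exists M, (fun x => c^-1 * g x); split.
- exact: lsmoothZ.
- by move=> x y xy; rewrite (dg x y xy).
apply/funext => x; rewrite /itot (lintZ _ _ _ lg)// -/(itot i g x).
by rewrite (itot_dep_only x x0 dg) mulVf.
Qed.

End Moments.

(** * Elimination of one coordinate from a distribution *)

Section CoordinateReduction.
Variables (R : realType) (d : nat).
Notation pt := 'cV[R]_d.
Notation e_ := (@ebasis R d).
Variables (T : distrib_fun R d) (m : nat).
Hypothesis TT : is_distribution T.
Hypothesis Tm : forall i f, test_fun f -> T (iter m (pd i) f) = 0.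
Variables (i : 'I_d) (M : R) (eta : pt -> R).
Hypothesis leta : lsmooth i M eta.
Hypothesis deta : dep_only i eta.
Hypothesis eta1 : itot i eta = fun=> 1.
Implicit Types (f g : pt -> R) (x : pt) (p : {poly R}).

Let residue f x := f x - eta x * itot i f x.
Let J f := iprim i (residue f).

Lemma residue_props f : test_fun f -> test_fun (residue f) /\ itot i (residue f) = fun=> 0.
Proof.
move=> tf; have tC := test_fun_Mitot leta tf; split; first exact: test_funB.
have [N1 lf] := test_fun_lsmooth i tf.
have [N2 lC] := test_fun_lsmooth i tC.
pose N := Num.max N1 N2.
have {}lf : lsmooth i N f by apply: lsmoothW lf; rewrite le_max lexx.
have {}lC : lsmooth i N (fun x => eta x * itot i f x).
  by apply: lsmoothW lC; rewrite le_max lexx orbT.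
apply/funext => x; rewrite /itot (lintB _ _ lf lC)// -!/(itot _ _ _).
by rewrite (itotMr _ leta) ?eta1 ?mul1r ?subrr// => t y; rewrite itot_set.
Qed.

Lemma test_fun_J f : test_fun f -> test_fun (J f).
Proof. by move=> /residue_props[tr r0]; exact: test_fun_iprim. Qed.

Lemma J_decomposition f : test_fun f -> f = fun x => eta x * itot i f x + pd i (J f) x.
Proof.
move=> /residue_props[tr _]; have [N lr] := test_fun_lsmooth i tr.
by rewrite /J (pd_iprim lr) /residue; apply/funext => x; rewrite addrC subrK.
Qed.

(** With [P' = p], integration by parts gives minus the moment of [P] against [f - eta * itot i f].
    The second term contributes [c * itot i f], where [c] is a constant because [eta] depends on
    [x_i] only; hence the polynomial [c - P]. *)
Lemma moment_J p : exists q, forall f, test_fun f -> moment i p (J f) = moment i q f.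
Proof.
have [P PE] := poly_antiderivative p.
pose c := moment i P eta 0; exists (c%:P - P) => f tf; apply/funext => x.
have [tr r0] := residue_props tf.
rewrite -PE /J (moment_iprim _ _ tr r0).
have tC := test_fun_Mitot leta tf.
have [N1 lf] := test_fun_lsmooth i tf.
have [N2 lC] := test_fun_lsmooth i tC.
pose N := Num.max N1 N2.
have {}lf : lsmooth i N f by apply: lsmoothW lf; rewrite le_max lexx.
have {}lC : lsmooth i N (fun x => eta x * itot i f x).
  by apply: lsmoothW lC; rewrite le_max lexx orbT.
have -> : moment i P (residue f) x = moment i P f x - c * itot i f x.
  have -> : moment i P (residue f) =
      itot i (fun y : pt => P.[y i 0] * f y - P.[y i 0] * (eta y * itot i f y)).
    by congr itot; apply/funext => y; rewrite mulrBr.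
  rewrite /itot (lintB _ _ (lsmooth_poly _ lf) (lsmooth_poly _ lC))//; congr (_ - _).
  rewrite -/(itot _ _ _) -/(itot i f x).
  have -> : (fun y : pt => P.[y i 0] * (eta y * itot i f y)) =
      (fun y => (P.[y i 0] * eta y) * itot i f y).
    by apply/funext => y; rewrite mulrA.
  rewrite (itotMr _ (lsmooth_poly P leta)); last by move=> t y; rewrite itot_set.
  congr (_ * _); apply: itot_dep_only => y z yz.
  by rewrite yz (deta yz).
have -> : moment i (c%:P - P) f = itot i (fun y : pt => c * f y - P.[y i 0] * f y).
  by congr itot; apply/funext => y; rewrite hornerD hornerN hornerC mulrBl.
rewrite /itot (lintB _ _ (lsmoothZ c lf) (lsmooth_poly P lf))// (lintZ _ _ _ lf)//.
by rewrite opprB.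
Qed.

Lemma test_fun_iterJ k f : test_fun f -> test_fun (iter k J f).
Proof. by move=> tf; elim: k => //= k; exact: test_fun_J. Qed.

Lemma itot_iterJ k : exists q, forall f, test_fun f -> itot i (iter k J f) = moment i q f.
Proof.
have H p : exists q, forall f, test_fun f -> moment i p (iter k J f) = moment i q f.
  elim: k p => [|k IH] p; first by exists p.
  have [q qE] := moment_J p; have [r rE] := IH q; exists r => f tf.
  by rewrite iterS qE ?rE//; exact: test_fun_iterJ.
have [q qE] := H 1; exists q => f tf; rewrite -qE//; congr itot.
by apply/funext => x; rewrite hornerC mul1r.
Qed.

Lemma pd_Mitot a N f : lsmooth i N a -> test_fun f ->
  pd i (fun x => a x * itot i f x) = fun x => pd i a x * itot i f x.
Proof.
move=> [_ ba _] tf; have [K lf] := test_fun_lsmooth i tf.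
rewrite pdM//; last exact: bsmooth_itot lf.
apply/funext => x; have -> : pd i (itot i f) x = 0.
  by have := is_derive_itot i x lf; rewrite eqxx => D0; exact: derive_val.
by rewrite mulr0 add0r mulrC.
Qed.

Lemma lsmooth_iter_pd k : lsmooth i M (iter k (pd i) eta).
Proof. by elim: k => //= k; exact: lsmooth_pd. Qed.

Lemma iter_pd_Mitot k f : test_fun f ->
  iter k (pd i) (fun x => eta x * itot i f x) = fun x => iter k (pd i) eta x * itot i f x.
Proof.
move=> tf; elim: k => //= k ->; exact: pd_Mitot (lsmooth_iter_pd k) tf.
Qed.

Lemma test_fun_iter_pd k f : test_fun f -> test_fun (iter k (pd i) f).
Proof. by move=> tf; elim: k => //= k; exact: test_fun_pd. Qed.

Lemma iter_pdD k f g : test_fun f -> test_fun g ->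
  iter k (pd i) (fun x => f x + g x) = fun x => iter k (pd i) f x + iter k (pd i) g x.
Proof.
move=> tf tg; elim: k => //= k ->.
by apply: pdD; exact/test_fun_bsmooth/test_fun_iter_pd.
Qed.

(** The remainder is expanded by decomposing [iter n J f]; the derivatives fall on [eta] alone,
    since [itot] is constant along [e_i]. At [n = m] the remainder is killed by [Tm]. *)
Lemma distr_coordinate_expansion n f : test_fun f ->
  T f = \sum_(k < n) T (fun x => iter k (pd i) eta x * itot i (iter k J f) x)
    + T (iter n (pd i) (iter n J f)).
Proof.
move=> tf; elim: n => [|n IH]; first by rewrite big_ord0 add0r.
rewrite IH big_ord_recr -addrA; congr (_ + _).
have tn := test_fun_iterJ n tf.
have tC := test_fun_Mitot leta tn.
have tJ := test_fun_pd i (test_fun_J tn).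
rewrite {1}(J_decomposition tn) iter_pdD// distrD//; last 2 first.
- exact: test_fun_iter_pd.
- exact: test_fun_iter_pd.
by rewrite iter_pd_Mitot// iterSr.
Qed.

Lemma distr_coordinate : exists (a : 'I_m -> pt -> R) (q : 'I_m -> {poly R}),
  [/\ forall k, lsmooth i M (a k), forall k, dep_only i (a k) &
   forall f, test_fun f -> T f = \sum_k T (fun x => a k x * moment i (q k) f x)].
Proof.
have /choice[q qE] (k : 'I_m) : exists q, forall f, test_fun f ->
    itot i (iter k J f) = moment i q f by exact: itot_iterJ.
exists (fun k => iter k (pd i) eta), q; split=> [k|k|f tf].
- exact: lsmooth_iter_pd.
- by elim: (nat_of_ord k) => //= l; exact: dep_only_pd.
rewrite (distr_coordinate_expansion m tf) Tm ?addr0; last exact: test_fun_iterJ.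
by apply: eq_bigr => k _; rewrite qE.
Qed.

End CoordinateReduction.

(** * The iterated integral of a test function *)

Section IteratedIntegral.
Variables (R : realType) (d : nat).
Notation pt := 'cV[R]_d.
Notation mu := (@lebesgue_measure R).
Implicit Types (f g : pt -> R) (x y : pt) (i j : 'I_d).

Lemma iintS (n : 'I_d) f x : iint n.+1 f x = itot n (iint n f) x.
Proof. by []. Qed.

(** The integrated coordinates no longer matter, so only support bounds in the remaining directions
    persist; the next integration uses one of them. *)
Lemma iint_lsmooth n f : (n <= d)%N -> test_fun f ->
  bsmooth (iint n f) /\ forall i, (n <= i)%N -> exists M, lsmooth i M (iint n f).
Proof.
move=> + tf; elim: n => [|n IH] nd.
  split=> [|i _]; first exact: (test_fun_bsmooth tf).
  exact: (test_fun_lsmooth i tf).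
have [_ ln] := IH (ltnW nd).
have [N lN] := ln (Ordinal nd) (leqnn _).
have bI : bsmooth (iint n.+1 f) by exact: (bsmooth_itot lN).
split=> // i ni; have [M [M0 _ sM]] := ln i (ltnW ni).
exists M; split=> // x Mx; rewrite (@iintS (Ordinal nd)) /itot /lint.
have -> : (fun t => iint n f (set_coord (Ordinal nd) t x)) = fun=> 0.
  by apply/funext => t; apply: sM; rewrite set_coord_neq// -val_eqE /= gtn_eqF.
by rewrite /Rintegral integral0.
Qed.

Definition dep_below n f :=
  forall x y, (forall i, (i < n)%N -> x i 0 = y i 0) -> f x = f y.

Definition dep_above n f :=
  forall x y, (forall i, (n <= i)%N -> x i 0 = y i 0) -> f x = f y.

Lemma iint_dep_above n f : dep_above n (iint n f).
Proof.
elim: n => [|n IH] x y xy /=.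
  by congr f; apply/colP => i; exact: xy.
congr Rintegral; apply/funext => t; apply: IH => i ni; rewrite !mxE.
by case: eqP => // /eqP ni'; apply: xy; rewrite ltn_neqAle eq_sym ni' ni.
Qed.

Lemma iintMl n (c f : pt -> R) : (n <= d)%N -> test_fun f -> dep_above n c ->
  iint n (fun x => c x * f x) = fun x => c x * iint n f x.
Proof.
move=> + tf; elim: n c => [//|n IH] c nd dc.
have [_ ln] := iint_lsmooth (ltnW nd) tf.
have [M lM] := ln (Ordinal nd) (leqnn _).
apply/funext => x.
have dcn : dep_above n c by move=> y z yz; apply: dc => i ni; exact/yz/ltnW.
rewrite (@iintS (Ordinal nd)) IH ?(ltnW nd)// (@iintS (Ordinal nd)).
rewrite /itot /lint -RintegralZl//; last exact: lsmooth_line_integrable lM.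
apply: eq_Rintegral => t _; congr (_ * _); apply: dc => i ni.
by rewrite set_coord_neq// -val_eqE /= gtn_eqF.
Qed.

Lemma iintD n f g : (n <= d)%N -> test_fun f -> test_fun g ->
  iint n (fun x => f x + g x) = fun x => iint n f x + iint n g x.
Proof.
move=> + tf tg; elim: n => [//|n IH] nd.
have [_ /(_ (Ordinal nd) (leqnn _))[M lM]] := iint_lsmooth (ltnW nd) tf.
have [_ /(_ (Ordinal nd) (leqnn _))[N lN]] := iint_lsmooth (ltnW nd) tg.
apply/funext => x; rewrite !(@iintS (Ordinal nd)) IH ?(ltnW nd)// /itot /lint.
by apply: RintegralD => //; [exact: lsmooth_line_integrable lM|exact: lsmooth_line_integrable lN].
Qed.

Lemma iint_sum n (I : Type) (r : seq I) (c : I -> R) (F : I -> pt -> R) : (n <= d)%N ->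
  (forall k, test_fun (F k)) ->
  iint n (fun x => \sum_(k <- r) c k * F k x) = fun x => \sum_(k <- r) c k * iint n (F k) x.
Proof.
move=> nd tF; have iZ (a : R) f : test_fun f ->
    iint n (fun x => a * f x) = fun x => a * iint n f x.
  by move=> tf; apply: (@iintMl n (fun=> a)).
elim: r => [|k r IH].
  have -> : (fun x => \sum_(k <- [::]) c k * F k x) = fun x => 0 * (fun=> 0) x.
    by apply/funext => x; rewrite big_nil mul0r.
  rewrite iZ; last exact: test_fun0.
  by apply/funext => x; rewrite big_nil mul0r.
have -> : (fun x => \sum_(k <- k :: r) c k * F k x) =
    fun x => c k * F k x + \sum_(k <- r) c k * F k x.
  by apply/funext => x; rewrite big_cons.
rewrite iintD//; last 2 first.
- exact: test_funZ.
- by apply: test_fun_sum => l; exact: test_funZ.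
by rewrite IH iZ//; apply/funext => x; rewrite big_cons.
Qed.

End IteratedIntegral.

(** * All coordinates together, and the theorem for distributions *)

Section DistributionCase.
Variables (R : realType) (d : nat).
Notation pt := 'cV[R]_d.
Implicit Types (f : pt -> R) (x : pt) (i : 'I_d) (T : distrib_fun R d).

(** The invariant separates variables: [A k] involves the coordinates below [n], the iterated
    integral those from [n] on. Each coordinate splits every term into [m] moments. Their being test
    functions is carried along, as [T] is controlled only there. *)
Lemma distr_partial_integration T m f0 (n : nat) : is_distribution T ->
    (forall i f, test_fun f -> T (iter m (pd i) f) = 0) ->
    test_fun f0 -> (exists x, f0 x != 0) -> (n <= d)%N ->
  exists (I : finType) (A Q : I -> pt -> R),
    [/\ forall k, dep_below n (A k), forall k, is_poly_fun (Q k),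
        forall k f, test_fun f -> test_fun (fun x => Q k x * f x),
        forall k f, test_fun f ->
          test_fun (fun x => A k x * iint n (fun y => Q k y * f y) x) &
        forall f, test_fun f ->
          T f = \sum_k T (fun x => A k x * iint n (fun y => Q k y * f y) x)].
Proof.
move=> TT Tm tf0 f0N; elim: n => [|n IH] nd.
  have E f : (fun x => 1 * f x) = f by apply/funext => x; rewrite mul1r.
  exists unit, (fun _ _ => 1), (fun _ _ => 1); split=> //.
  - by move=> _; exact: is_poly_cst.
  - by move=> _ f tf; rewrite E.
  - by move=> _ f tf /=; rewrite E E.
  - by move=> f tf; rewrite (big_pred1 tt) /= ?E//; case.
have [I [A [Q [dA pQ tQ tA TE]]]] := IH (ltnW nd).
pose i := Ordinal nd.
have [M [eta [leta deta eta1]]] := exists_bump i tf0 f0N.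
have [a [q [la da aE]]] := distr_coordinate TT Tm leta deta eta1.
pose A' (kl : I * 'I_m) x := A kl.1 x * a kl.2 x.
pose Q' (kl : I * 'I_m) x := (q kl.2).[x i 0] * Q kl.1 x.
have tQ' kl f : test_fun f -> test_fun (fun x => Q' kl x * f x).
  move=> tf; have := test_fun_poly i (q kl.2) (tQ kl.1 f tf).
  by congr test_fun; apply/funext => x; rewrite /Q' mulrA.
(* [A k], independent of coordinate [n], leaves the integral over it; the polynomial in that
   coordinate passes inside the integral over the lower ones, which gives the next stage of
   [iint]. *)
have key k l f : test_fun f ->
    (fun x => a l x * moment i (q l) (fun x => A k x * iint n (fun y => Q k y * f y) x) x) =
    (fun x => A' (k, l) x * iint n.+1 (fun y => Q' (k, l) y * f y) x).
  move=> tf; apply/funext => x; rewrite /A' /= mulrAC mulrC; congr (_ * _).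
  have [_ /(_ i (leqnn _))[K lK]] := iint_lsmooth (ltnW nd) (tQ' (k, l) f tf).
  rewrite -RintegralZl//; last exact: lsmooth_line_integrable lK.
  apply: eq_Rintegral => t _; rewrite mulrCA.
  rewrite (dA k _ x); last first.
    by move=> j jn; rewrite set_coord_neq// -val_eqE /= ltn_eqF.
  congr (_ * _).
  have -> : (fun y => Q' (k, l) y * f y) = (fun y => (q l).[y i 0] * (Q k y * f y)).
    by apply/funext => y; rewrite /Q' mulrA.
  rewrite (@iintMl _ _ n (fun y => (q l).[y i 0])) ?(ltnW nd)//; first exact: tQ.
  by move=> y z yz; rewrite yz.
exists (I * 'I_m)%type, A', Q'; split=> [kl|kl|//|[k l] f tf|f tf].
- move=> x y xy; rewrite /A'; congr (_ * _); first by apply: dA => j jn; exact/xy/ltnW.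
  by apply: da; exact: xy.
- exact: is_polyM1.
- rewrite -key//; have [K lK] := test_fun_lsmooth i (tA k f tf).
  apply: (test_fun_Mitot (la l)); exact/test_fun_poly/tA.
rewrite TE// [RHS](eq_bigr (fun kl : I * 'I_m => T (fun x => a kl.2 x *
  moment i (q kl.2) (fun x => A kl.1 x * iint n (fun y => Q kl.1 y * f y) x) x))); last first.
  by move=> [k l] _; rewrite key.
rewrite -(pair_bigA _ (fun k l => T (fun x => a l x *
  moment i (q l) (fun x => A k x * iint n (fun y => Q k y * f y) x) x))) /=.
by apply: eq_bigr => k _; apply: aE; exact: tA.
Qed.

(** If every test function vanishes, the polynomial [0] represents [T]; otherwise a nonzero one
    feeds [exists_bump]. At [n = d] the iterated integral is a constant function, which leaves
    [T (A k)] as coefficient of [Q k]. *)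
Lemma distr_pd_nilpotent_poly T m : is_distribution T ->
  (forall i f, test_fun f -> T (iter m (pd i) f) = 0) -> distr_is_poly T.
Proof.
move=> TT Tm.
have [[f0 [tf0 f0N]]|nf] := pselect (exists f0 : pt -> R, test_fun f0 /\ exists x, f0 x != 0).
  have [I [A [Q [dA pQ tQ tA TE]]]] := distr_partial_integration TT Tm tf0 f0N (leqnn d).
  exists (fun x => \sum_k T (A k) * Q k x); split.
    by apply: is_poly_sum => k; exact: is_polyZ.
  move=> f tf; rewrite TE// /integral_Rd.
  have -> : (fun x => (\sum_k T (A k) * Q k x) * f x) =
      fun x => \sum_k T (A k) * (Q k x * f x).
    by apply/funext => x; rewrite mulr_suml; apply: eq_bigr => k _; rewrite mulrA.
  rewrite iint_sum//; last by move=> k; exact: tQ.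
  apply: eq_bigr => k _; have := tA k f tf.
  set c := iint d (fun y => Q k y * f y) 0.
  have -> : (fun x => A k x * iint d (fun y => Q k y * f y) x) = fun x => c * A k x.
    apply/funext => x; rewrite mulrC; congr (_ * _).
    by apply: iint_dep_above => i; rewrite leqNgt ltn_ord.
  (* Only [c * A k] is known to be a test function. For [c = 0] both sides vanish whatever [T (A k)]
     is; otherwise division by [c] makes [A k] one. *)
  move=> tcA; rewrite [RHS]mulrC; have [c0|cN0] := eqVneq c 0.
    rewrite c0 mul0r -[RHS](distr0 TT); congr T.
    by apply/funext => x; rewrite mul0r.
  have tAk : test_fun (A k).
    have := test_funZ c^-1 tcA; congr test_fun.
    by apply/funext => x; rewrite mulrA mulVf ?mul1r.
  exact: distrZ.
have f0 f : test_fun f -> f = fun=> 0.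
  move=> tf; apply/funext => x; apply/eqP/negPn/negP => fx.
  by apply: nf; exists f; split=> //; exists x.
exists (fun=> 0); split; first exact: is_poly_cst.
move=> f /f0 ->; rewrite (distr0 TT) /integral_Rd.
rewrite (@iintMl _ _ d (fun=> 0) (fun=> 0))//; last exact: test_fun0.
by rewrite mul0r.
Qed.

(** Elements of [V] are compared on test functions only. Setting all other values to [0] turns [deq]
    into equality, so that linear algebra in the space of functionals applies. *)
Definition restrict_test (T : distrib_fun R d) : distrib_fun R d :=
  fun f => if `[< test_fun f >] then T f else 0.

Lemma restrict_testE T f : test_fun f -> restrict_test T f = T f.
Proof. by rewrite /restrict_test => /asboolP ->. Qed.

Lemma restrict_test_eq (T S : distrib_fun R d) :
  (forall f, test_fun f -> T f = S f) -> restrict_test T = restrict_test S.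
Proof.
by move=> TS; apply/funext => f; rewrite /restrict_test; case: asboolP => // /TS.
Qed.

(** Both directions matter: the cut-off must treat [f] and its translate alike in order to commute
    with [dtau]. *)
Lemma test_fun_translateE b f : test_fun (fun x => f (x - b)) <-> test_fun f.
Proof.
split=> [tf|]; last exact: test_fun_translate.
have := test_fun_translate b tf; congr test_fun.
by apply/funext => x; rewrite addrK.
Qed.

Lemma test_fun_linearE (P : 'M[R]_d) f : P \in unitmx ->
  test_fun (fun x => f (P *m x)) <-> test_fun f.
Proof.
move=> Pu; split=> [tf|]; last exact: test_fun_linear.
have := @test_fun_linear _ _ _ (invmx P) _ tf; rewrite unitmx_inv => /(_ Pu).
by congr test_fun; apply/funext => x; rewrite mulmxA mulmxV ?mul1mx.
Qed.

Lemma restrict_test_dtau h T : dtau h (restrict_test T) = restrict_test (dtau h T).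
Proof.
apply/funext => f; rewrite /dtau /restrict_test; congr (if _ then _ else _).
exact/asbool_equiv_eq/test_fun_translateE.
Qed.

Lemma restrict_test_dO P T : P \in unitmx ->
  dO P (restrict_test T) = restrict_test (dO P T).
Proof.
move=> Pu; apply/funext => f; rewrite /dO /restrict_test.
have -> : `[< test_fun (fun x => f (invmx P *m x)) >] = `[< test_fun f >].
  by apply/asbool_equiv_eq/test_fun_linearE; rewrite unitmx_inv.
by case: ifP => _; rewrite ?mulr0.
Qed.

Theorem distribution_case (G : set 'M[R]_d) (V : set (distrib_fun R d)) (z0 : pt) :
    is_subgroup_GL G -> fdim_subspace_D V -> interior (Lambda G z0) !=set0 ->
    (forall h T, V T -> exists S, V S /\ deq (dtau h T) S) ->
    (forall P T, G P -> V T -> exists S, V S /\ deq (dO P T) S) ->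
  forall T, V T -> distr_is_poly T.
Proof.
move=> GG [VD [V0 [VA [VZ [n [b Vb]]]]]] LG VT VO T TV.
have Gu P : G P -> P \in unitmx by case: GG => + _; exact.
pose V' : set (distrib_fun R d) := [set F | exists2 S, V S & F = restrict_test S].
have [|||||||||||m Tm] := @translations_unipotent R d (distrib_fun R d) G z0 V' n
  (fun k => restrict_test (b k)) (@dtau R d) (@dO R d) GG LG.
- move=> _ [S /Vb[c cS] ->]; exists (\row_k c k); apply/funext => f.
  have sE k : ((\row_k c k) 0 k *: restrict_test (b k)) f = c k * restrict_test (b k) f.
    by rewrite mxE.
  rewrite /lincomb fct_sumE; have [tf|tf] := pselect (test_fun f).
    rewrite restrict_testE// cS//; apply: eq_bigr => k _.
    by rewrite sE restrict_testE.
  have r0 F : restrict_test F f = 0 by rewrite /restrict_test asboolF.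
  by rewrite r0 big1// => k _; rewrite sE r0 mulr0.
- by [].
- by [].
- by move=> P u v; apply/funext => f; rewrite /dO mulrDr.
- by move=> P a u; apply/funext => f; rewrite /dO /= mulrCA.
- by move=> F; apply/funext => f; rewrite /dtau; congr F; apply/funext => x; rewrite subr0.
- move=> h k F; apply/funext => f; rewrite /dtau; congr F; apply/funext => x.
  by rewrite opprD addrA addrAC.
- move=> P F /Gu Pu; apply/funext => f; rewrite /dO mulrA invmxK.
  rewrite -invfM -normrM -det_mulmx mulmxV// det1 normr1 invr1 mul1r.
  by congr F; apply/funext => x; rewrite mulmxA mulVmx// mul1mx.
- move=> P h F /Gu Pu; apply/funext => f; rewrite /dO /dtau; congr (_ * F _).
  by apply/funext => x; rewrite mulmxBr.
- move=> h _ [S VS ->]; have [S' [VS' SS']] := VT h S VS.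
  by exists S' => //; rewrite restrict_test_dtau; exact: restrict_test_eq.
- move=> P _ GP [S VS ->]; have [S' [VS' SS']] := VO P S GP VS.
  by exists S' => //; rewrite restrict_test_dO ?Gu//; exact: restrict_test_eq.
have TT := VD T TV.
have rE k h f : test_fun f ->
    iter k (fun F : distrib_fun R d => dtau h F - F) (restrict_test T) f =
    iter k (fun F => fun g => dtau h F g - F g) T f.
  elim: k f => [|k IH] f tf; first exact: restrict_testE.
  rewrite !iterS; transitivity
    (iter k (fun F : distrib_fun R d => dtau h F - F) (restrict_test T) (fun x => f (x - h))
    - iter k (fun F : distrib_fun R d => dtau h F - F) (restrict_test T) f); first by [].
  by rewrite !IH//; exact/test_fun_translateE.
apply: (@distr_pd_nilpotent_poly T m) => // i f tf.
apply: (distr_pd_annihilates TT) => // h g tg.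
by rewrite -rE// (Tm h (restrict_test T))//; exists T.
Qed.

End DistributionCase.

Theorem mainTheorem2 :
  (* case X_d = C(R^d) *)
  (forall (R : realType) (d : nat) (G : set 'M[R]_d) (V : set ('cV[R]_d -> R))
      (z0 : 'cV[R]_d),
    is_subgroup_GL G ->
    fdim_subspace_C V ->
    interior (Lambda G z0) !=set0 ->
    (forall (h : 'cV[R]_d) f, V f -> V (ftau h f)) ->
    (forall P f, G P -> V f -> V (fO P f)) ->
    forall f, V f -> is_poly_fun f) /\
  (* case X_d = D(R^d)' *)
  (forall (R : realType) (d : nat) (G : set 'M[R]_d) (V : set (distrib_fun R d))
      (z0 : 'cV[R]_d),
    is_subgroup_GL G ->
    fdim_subspace_D V ->
    interior (Lambda G z0) !=set0 ->
    (forall (h : 'cV[R]_d) T, V T -> exists S, V S /\ deq (dtau h T) S) ->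
    (forall P T, G P -> V T -> exists S, V S /\ deq (dO P T) S) ->
    forall T, V T -> distr_is_poly T).
Proof.
split=> R d G V z0.
  exact: continuous_case.
exact: distribution_case.
Qed.
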